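(* Let $f:\mathcal A(\Sigma)\to\mathcal A(\Sigma')$ be a noncontractible surjective rooted cluster morphism and let $s=\#\widetilde X-\#\widetilde X'$. Then either $f=g_0$ (case $s=0$), or $f=g_sf_s\cdots f_2f_1$ ($s\ge1$) for a series of surjective rooted cluster morphisms $$\mathcal A(\Sigma)\xrightarrow{f_1}\mathcal A(\Sigma_1)\xrightarrow{f_2}\cdots\xrightarrow{f_{s-1}}\mathcal A(\Sigma_{s-1})\xrightarrow{f_s}\mathcal A(\Sigma_s)\xrightarrow{g_s}\mathcal A(\Sigma'),$$ where $g_s$ is a rooted cluster isomorphism (also for $s=0$) and, for $i=1,\dots,s$, with $\Sigma_0=\Sigma$, $\Sigma_i$ is the seed obtained from $\Sigma_{i-1}$ by gluing a pair of frozen variables having the same image under $f$ and $f_i$ is the canonical morphism on $\mathcal A(\Sigma_{i-1})$ induced by this gluing. (Here the image under $f$ of a gluing variable is understood to be the common image of the variables glued to form it.)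
   Context: **Seeds and cluster algebras.** A seed $\Sigma=(X,X_{fr},\widetilde B)$ consists of disjoint finite sets $X=\{x_1,\dots,x_n\}$ (the cluster; its elements are exchangeable variables; $X=\emptyset$ is allowed) and $X_{fr}=\{x_{n+1},\dots,x_{n+m}\}$ (frozen variables) such that the extended cluster $\widetilde X=X\cup X_{fr}$ is algebraically independent over $\mathbb Q$ and generates the field $\mathbb F(\Sigma)=\mathbb Q(\widetilde X)$, together with an integer matrix $\widetilde B=(b_{xy})_{x\in X,y\in\widetilde X}$ whose principal part $B=(b_{xy})_{x,y\in X}$ is totally sign-skew-symmetric: every matrix obtained from it by finitely many mutations is sign-skew-symmetric (for all $x,y$, either $b_{xy}=b_{yx}=0$ or $b_{xy}b_{yx}<0$). For $x\in X$ the mutation $\mu_x(\Sigma)$ replaces $x$ by $\mu_x(x)=x^{-1}\bigl(\prod_{b_{xt}>0}t^{b_{xt}}+\prod_{b_{xt}<0}t^{-b_{xt}}\bigr)$ ($t\in\widetilde X$), fixes the other variables ($\mu_x(y)=y$ for $y\ne x$), and replaces $\widetilde B$ by the matrix with entries $-b_{yz}$ if $y=x$ or $z=x$, and $b_{yz}+\frac{|b_{yx}|b_{xz}+b_{yx}|b_{xz}|}{2}$ otherwise (relabelling $x$ as $\mu_x(x)$). $\mathcal A(\Sigma)$ is the $\mathbb Z[X_{fr}]$-subalgebra of $\mathbb F(\Sigma)$ generated by all cluster variables in all seeds obtained from $\Sigma$ by iterated mutations; together with its initial seed $\Sigma$ it is called a rooted cluster algebra. **Rooted cluster morphisms.** A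 sequence $(y_1,\dots,y_l)$ is $\Sigma$-admissible if $y_1$ is exchangeable in $\Sigma$ and $y_i$ is exchangeable in $\mu_{y_{i-1}}\cdots\mu_{y_1}(\Sigma)$ for $i\ge2$; it is $(f,\Sigma,\Sigma')$-biadmissible if moreover $(f(y_1),\dots,f(y_l))$ is $\Sigma'$-admissible. A rooted cluster morphism $f:\mathcal A(\Sigma)\to\mathcal A(\Sigma')$ is a unital ring homomorphism with (CM1) $f(\widetilde X)\subseteq\widetilde X'\sqcup\mathbb Z$; (CM2) $f(X)\subseteq X'\sqcup\mathbb Z$; (CM3) $f(\mu_{y_s}\cdots\mu_{y_1}(y))=\mu_{f(y_s)}\cdots\mu_{f(y_1)}(f(y))$ for every $(f,\Sigma,\Sigma')$-biadmissible sequence $(y_1,\dots,y_s)$ and every $y\in\widetilde X$ (mutations fix integers). It is a rooted cluster isomorphism if it is injective and surjective. It is noncontractible if $\{x\in\widetilde X\mid f(x)\in\mathbb Z\}=\emptyset$. **Gluing.** For two distinct frozen variables $y_1,y_2\in X_{fr}$ of $\Sigma$, the glued seed $\Sigma_{\widehat{y_1y_2}}$ has cluster $X$, extended cluster $(\widetilde X\setminus\{y_1,y_2\})\cup\{\overline y\}$ with a new frozen variable $\overline y$ (the gluing variable of $y_1,y_2$), and extended exchange matrix $\overline b_{xy}=b_{xy}$ for $y\neq\overline y$, $\overline b_{x\overline y}=b_{xy_1}+b_{xy_2}$ ($x\in X$). The canonical morphism induced by gluing $y_1,y_2$ is the restriction to $\mathcal A(\Sigma)$ of the ring homomorphism $\pi:\mathbb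 Q[X_{fr}][X^{\pm1}]\to\mathbb F(\Sigma_{\widehat{y_1y_2}})$ with $\pi(x)=x$ for $x\in\widetilde X\setminus\{y_1,y_2\}$ and $\pi(y_1)=\pi(y_2)=\overline y$. *)

(* Defs.v *)
From HB Require Import structures.
From mathcomp Require Import all_boot all_order all_algebra.
From mathcomp Require Import finmap boolp.
From mathcomp.multinomials Require Import mpoly.

Set Implicit Arguments.
Unset Strict Implicit.
Unset Printing Implicit Defensive.

Import GRing.Theory Num.Theory.

Local Open Scope fset_scope.
Local Open Scope ring_scope.

(** * Generated subrings of a field, as rings *)

Section GeneratedSubring.
Variables (F : fieldType) (G : F -> Prop).

Definition subring_gen : {pred F} := fun a =>
  `[< forall P : {pred F}, subring_closed P ->
        (forall g, G g -> g \in P) -> a \in P >].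

Lemma subring_genP a : reflect
  (forall P : {pred F}, subring_closed P ->
     (forall g, G g -> g \in P) -> a \in P)
  (a \in subring_gen).
Proof. exact: asboolP. Qed.

Lemma subring_gen_closed : subring_closed subring_gen.
Proof.
split=> [|a b /subring_genP aG /subring_genP bG
         |a b /subring_genP aG /subring_genP bG];
  apply/subring_genP => P Pring GP; have [P1 PB PM] := Pring.
- exact: P1.
- by apply: PB; [apply: aG | apply: bG].
- by apply: PM; [apply: aG | apply: bG].
Qed.

Lemma subring_gen_sub g : G g -> g \in subring_gen.
Proof. by move=> Gg; apply/subring_genP => P _; apply. Qed.

HB.instance Definition _ :=
  GRing.isSubringClosed.Build F subring_gen subring_gen_closed.

Record gen_ring := GenRing { gen_val : F; _ : gen_val \in subring_gen }.

HB.instance Definition _ := [isSub for gen_val].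
HB.instance Definition _ := [Choice of gen_ring by <:].
HB.instance Definition _ := [SubChoice_isSubComNzRing of gen_ring by <:].

End GeneratedSubring.

(** * Matrices indexed by elements of a type *)

(* Matrices are total functions; only their values on the relevant index sets
   carry meaning. *)
Section MatrixMutation.
Variable T : choiceType.
Implicit Types (b : T -> T -> int) (x y z : T).

(* The numerator is always even, so the integer division is exact. *)
Definition mutate_mx b x : T -> T -> int := fun y z =>
  if (y == x) || (z == x) then - b y z
  else b y z + ((`|b y x| * b x z + b y x * `|b x z|) %/ 2)%Z.

Definition sign_skew_symmetric (X : {fset T}) b : Prop :=
  forall x y, x \in X -> y \in X ->
    (b x y = 0 /\ b y x = 0) \/ b x y * b y x < 0.

Definition totally_sign_skew_symmetric (X : {fset T}) b : Prop :=
  forall s : seq T, {subset s <= X} ->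
    sign_skew_symmetric X (foldl mutate_mx b s).

End MatrixMutation.

(** * Seeds and mutations *)

(* The combinatorial data of a seed inside an ambient field: exchangeable
   variables, frozen variables, and extended exchange matrix, of which only
   the entries [bmx x y] with [x] exchangeable and [y] in the extended
   cluster are meaningful. *)
Record seed_data (F : fieldType) := SeedData {
  exch : {fset F};
  froz : {fset F};
  bmx : F -> F -> int
}.

Section SeedData.
Variable F : fieldType.
Implicit Types (D : seed_data F) (x y : F) (s : seq F).

Definition ext D : {fset F} := exch D `|` froz D.

Definition alg_independent (S : {fset F}) : Prop :=
  forall p : {mpoly rat[#|` S|]},
    mmap (ratr : rat -> F) (fun i => (enum_fset S)`_i) p = 0 -> p = 0.

Definition generates_field (S : {fset F}) : Prop :=
  forall P : {pred F}, divring_closed P -> {subset S <= P} ->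
    forall a, a \in P.

(* Characteristic 0 makes [ratr] the inclusion of the rationals in [F]. *)
Record is_seed D : Prop := IsSeed {
  seed_char0 : [pchar F] =i pred0;
  seed_disjoint : [disjoint exch D & froz D]%fset;
  seed_independent : alg_independent (ext D);
  seed_generates : generates_field (ext D);
  seed_tsss : totally_sign_skew_symmetric (exch D) (bmx D)
}.

Definition exchange D x : F :=
  x^-1 * (\prod_(t <- ext D | 0 < bmx D x t) t ^ (bmx D x t)
          + \prod_(t <- ext D | bmx D x t < 0) t ^ (- bmx D x t)).

Definition mutate_var D x y : F := if y == x then exchange D x else y.

(* In the new matrix the index [exchange D x] plays the role of [x]; in a seed
   it never belongs to the old extended cluster, by algebraic independence. *)
Definition mutate D x : seed_data F :=
  let old u := if u == exchange D x then x else u in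
  SeedData (exchange D x |` (exch D `\ x)) (froz D)
    (fun y z => mutate_mx (bmx D) x (old y) (old z)).

Fixpoint admissible D s : bool :=
  if s is y :: s' then (y \in exch D) && admissible (mutate D y) s' else true.

Definition mutate_seq D s : seed_data F := foldl mutate D s.

(* [mutate_var_seq D [:: y1; ...; yl] y] is mu_yl ... mu_y1 (y). *)
Fixpoint mutate_var_seq D s y : F :=
  if s is x :: s' then mutate_var_seq (mutate D x) s' (mutate_var D x y) else y.

Definition cluster_variable D x : Prop :=
  exists2 s, admissible D s & x \in exch (mutate_seq D s).

End SeedData.

Record seed := Seed {
  seed_field : fieldType;
  seed_of : seed_data seed_field;
  seedP : is_seed seed_of
}.

Definition cluster (S : seed) : {fset seed_field S} := exch (seed_of S).
Definition frozen (S : seed) : {fset seed_field S} := froz (seed_of S).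
Definition xcluster (S : seed) : {fset seed_field S} := ext (seed_of S).

(** * Rooted cluster algebras and their morphisms *)

(* The Z[frozen]-subalgebra generated by the cluster variables is the subring
   generated by the frozen variables and the cluster variables. *)
Definition cluster_algebra (S : seed) :=
  gen_ring (fun x : seed_field S =>
    x \in frozen S \/ cluster_variable (seed_of S) x).

Definition is_integer (R : pzRingType) (a : R) : Prop :=
  exists k : int, a = k%:~R.

Section Morphisms.
Variables S S' : seed.
Implicit Type f : {rmorphism cluster_algebra S -> cluster_algebra S'}.

Definition biadmissible f (s : seq (cluster_algebra S)) : bool :=
  admissible (seed_of S) [seq val u | u <- s]
  && admissible (seed_of S') [seq val (f u) | u <- s].

(* In the third condition [z] is the element mu_ys ... mu_y1 (y), which is a
   frozen variable or a cluster variable of [S]. *)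
Record rooted_cluster_morphism f : Prop := RootedClusterMorphism {
  rcm_ext : forall x : cluster_algebra S, val x \in xcluster S ->
    val (f x) \in xcluster S' \/ is_integer (f x);
  rcm_exch : forall x : cluster_algebra S, val x \in cluster S ->
    val (f x) \in cluster S' \/ is_integer (f x);
  rcm_mutation : forall (s : seq (cluster_algebra S))
      (y z : cluster_algebra S),
    biadmissible f s -> val y \in xcluster S ->
    val z = mutate_var_seq (seed_of S) [seq val u | u <- s] (val y) ->
    val (f z) =
      mutate_var_seq (seed_of S') [seq val (f u) | u <- s] (val (f y))
}.

Definition surjective_map (A B : Type) (h : A -> B) : Prop :=
  forall b, exists a, h a = b.

Definition rooted_cluster_isomorphism f : Prop :=
  [/\ rooted_cluster_morphism f, injective f & surjective_map f].

Definition noncontractible f : Prop :=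
  forall x : cluster_algebra S, val x \in xcluster S -> ~ is_integer (f x).

End Morphisms.

(** * Gluing frozen variables *)

(* Q[frozen][cluster^{+-1}] *)
Definition laurent_ring (S : seed) :=
  gen_ring (fun x : seed_field S =>
    [\/ exists q : rat, x = ratr q,
        x \in xcluster S
      | exists2 y, y \in cluster S & x = y^-1]).

Section Gluing.
Variables S S1 : seed.

(* The remaining variables of [S] are named in the field of [S1] by [e]. *)
Record is_glued_seed (y1 y2 : seed_field S)
    (e : seed_field S -> seed_field S1) (ybar : seed_field S1) : Prop :=
  IsGluedSeed {
    glued_frozen1 : y1 \in frozen S;
    glued_frozen2 : y2 \in frozen S;
    glued_neq : y1 != y2;
    glued_inj : {in xcluster S `\` [fset y1; y2] &, injective e};
    glued_new : forall x, x \in xcluster S `\` [fset y1; y2] -> e x != ybar;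
    glued_cluster : cluster S1 = [fset e x | x in cluster S];
    glued_frozen : frozen S1 =
      ybar |` [fset e x | x in frozen S `\` [fset y1; y2]];
    glued_bmx : forall x y, x \in cluster S ->
      y \in xcluster S `\` [fset y1; y2] ->
      bmx (seed_of S1) (e x) (e y) = bmx (seed_of S) x y;
    glued_bmx_bar : forall x, x \in cluster S ->
      bmx (seed_of S1) (e x) ybar =
        bmx (seed_of S) x y1 + bmx (seed_of S) x y2
  }.

(* [f] is the restriction to the cluster algebra of the substitution [p];
   the cluster algebra lies in the Laurent ring by the Laurent phenomenon. *)
Definition canonical_gluing (y1 y2 : seed_field S)
    (e : seed_field S -> seed_field S1) (ybar : seed_field S1)
    (f : cluster_algebra S -> cluster_algebra S1) : Prop :=
  exists p : {rmorphism laurent_ring S -> seed_field S1},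
    [/\ forall x : laurent_ring S,
          val x \in xcluster S `\` [fset y1; y2] -> p x = e (val x),
        forall x : laurent_ring S, val x \in [fset y1; y2] -> p x = ybar
      & forall (a : cluster_algebra S) (l : laurent_ring S),
          val a = val l -> val (f a) = p l].

End Gluing.

(* [gluing_chain f h im] means that [h] is a composite f_i o ... o f_1 from the
   algebra of [S] to that of [Si], where each step is the canonical morphism
   gluing two frozen variables with the same image under [f].  The map [im]
   records the images under [f] of the variables of [Si]: the image of a
   gluing variable is that of the variables glued; values of [im] elsewhere
   than on the extended cluster are irrelevant. *)
Inductive gluing_chain (S S' : seed)
    (f : {rmorphism cluster_algebra S -> cluster_algebra S'}) :
  nat -> forall Si : seed, (cluster_algebra S -> cluster_algebra Si) ->
    (cluster_algebra Si -> cluster_algebra S') -> Prop :=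
| GluingChain0 : gluing_chain f 0 (fun a : cluster_algebra S => a) f
| GluingChainS (i : nat) (Si : seed)
    (h : cluster_algebra S -> cluster_algebra Si)
    (im : cluster_algebra Si -> cluster_algebra S')
    (Sj : seed) (y1 y2 : cluster_algebra Si)
    (e : seed_field Si -> seed_field Sj) (ybar : seed_field Sj)
    (fj : {rmorphism cluster_algebra Si -> cluster_algebra Sj})
    (imj : cluster_algebra Sj -> cluster_algebra S') :
    gluing_chain f i h im ->
    im y1 = im y2 ->
    is_glued_seed (val y1) (val y2) e ybar ->
    canonical_gluing (val y1) (val y2) e ybar fj ->
    rooted_cluster_morphism fj -> surjective_map fj ->
    (forall x : cluster_algebra Si, val x \in xcluster Si ->
       imj (fj x) = im x) ->
    gluing_chain f i.+1 (fun a => fj (h a)) imj.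

(* Main.v *)
(** Fix labels, the initial variables [L] of the source seed, and let each label
    carry a variable of whichever seed is considered.  Then [f] sends the
    variable carried by a label after a sequence of mutations to the variable
    carried by the image label, and, in place of the Laurent phenomenon, one
    evaluates rational functions at points of a field: cluster variables are
    subtraction-free, so they are regular and positive at positive points, even
    when one unmutated variable is set to 0, and running the mutations backwards
    shows that the variables of a mutated seed take arbitrary positive values,
    hence stay distinct.

    This forces [f] to separate exchangeable variables from all other variables
    and to be surjective on extended clusters (no rational function of the image
    variables equals a missed one).  If two frozen variables [y1], [y2] have the
    same image, evaluating the exchange relations where this image vanishes shows
    that in every mutated matrix their columns never have entries of opposite
    signs in the same row; this is exactly what makes gluing commute with
    mutation.  The gluing substitution and the induced map from the glued algebra
    are then again evaluations of rational functions.  Once no two variables have the same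
    image, [f] is inverted by the evaluation sending variables back. *)

Require Import Defs.
From HB Require Import structures.
From mathcomp Require Import all_boot all_order all_algebra.
From mathcomp Require Import finmap boolp.
From mathcomp.multinomials Require Import mpoly.
From mathcomp Require Import zify.

Set Implicit Arguments.
Unset Strict Implicit.
Unset Printing Implicit Defensive.

Import Order.TTheory GRing.Theory Num.Theory.

Local Open Scope fset_scope.
Local Open Scope ring_scope.

(** * Induction over generated subrings *)

Section GenRing.
Variables (F : fieldType) (G : F -> Prop).

Lemma gen_ring_ind (P : gen_ring G -> Prop) :
  P 1 -> (forall u v, P u -> P v -> P (u - v)) ->
  (forall u v, P u -> P v -> P (u * v)) ->
  (forall u, G (val u) -> P u) -> forall u, P u.
Proof.
move=> P1 PB PM PG u.
pose Q : {pred F} := fun a => `[< exists2 v : gen_ring G, val v = a & P v >].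
suff /asboolP[v /val_inj <-] : val u \in Q by [].
have /subring_genP := valP u; apply; first split.
- by apply/asboolP; exists 1; rewrite ?rmorph1.
- move=> _ _ /asboolP[a <- Pa] /asboolP[b <- Pb]; apply/asboolP.
  by exists (a - b); [rewrite rmorphB | apply: PB].
- move=> _ _ /asboolP[a <- Pa] /asboolP[b <- Pb]; apply/asboolP.
  by exists (a * b); [rewrite rmorphM | apply: PM].
move=> g Gg; apply/asboolP; exists (GenRing (subring_gen_sub Gg)) => //.
exact: PG.
Qed.

End GenRing.

(** * Partially defined ring homomorphisms *)

Section PartialHom.
Variables A B : comPzRingType.

(* The graph of a ring homomorphism from a subring of [A] to [B]. *)
Record partial_hom (R : A -> B -> Prop) : Prop := PartialHom {
  phom_uniq : forall a b c, R a b -> R a c -> b = c;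
  phom1 : R 1 1;
  phomB : forall a b c d, R a b -> R c d -> R (a - c) (b - d);
  phomM : forall a b c d, R a b -> R c d -> R (a * c) (b * d)
}.

Variable R : A -> B -> Prop.
Hypothesis R_hom : partial_hom R.

Lemma phom0 : R 0 0.
Proof. by have := phomB R_hom (phom1 R_hom) (phom1 R_hom); rewrite !subrr. Qed.

Lemma phomD a b c d : R a b -> R c d -> R (a + c) (b + d).
Proof.
move=> Rab Rcd; have := phomB R_hom Rab (phomB R_hom phom0 Rcd).
by rewrite !sub0r !opprK.
Qed.

Lemma phomX a b n : R a b -> R (a ^+ n) (b ^+ n).
Proof.
move=> Rab; elim: n => [|n IHn]; first by rewrite !expr0; apply: phom1.
by rewrite !exprS; apply: phomM.
Qed.

Lemma phom_prod (T : eqType) (r : seq T) (E : T -> A) (E' : T -> B) :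
  (forall t, t \in r -> R (E t) (E' t)) ->
  R (\prod_(t <- r) E t) (\prod_(t <- r) E' t).
Proof.
move=> RE; rewrite big_seq [\prod_(t <- r) E' t]big_seq.
apply: (big_ind2 R) => //; first exact: phom1 R_hom.
by move=> *; apply: (phomM R_hom).
Qed.

Lemma phom_total : (forall a, exists b, R a b) ->
  exists f : {rmorphism A -> B}, forall a, R a (f a).
Proof.
move=> tot; pose f a := projT1 (cid (tot a)).
have Rf a : R a (f a) by rewrite /f; case: cid.
have fB : zmod_morphism f.
  by move=> a b; apply: (phom_uniq R_hom (Rf _)); apply: (phomB R_hom).
have fM : monoid_morphism f.
  split=> [|a b]; apply: (phom_uniq R_hom (Rf _)); first exact: phom1.
  exact: (phomM R_hom).
pose fa := GRing.isZmodMorphism.Build A B f fB.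
pose fm := GRing.isMonoidMorphism.Build A B f fM.
pose frm : {rmorphism A -> B} := HB.pack f fa fm.
by exists frm.
Qed.

End PartialHom.

Lemma phom_sub (F K : fieldType) (G : F -> Prop) (H : K -> Prop)
    (R : F -> K -> Prop) : partial_hom R ->
  partial_hom (fun (a : gen_ring G) (b : gen_ring H) => R (val a) (val b)).
Proof.
move=> Rh; split=> [a b c Rb Rc||a b c d|a b c d].
- exact/val_inj/(phom_uniq Rh Rb Rc).
- by rewrite !rmorph1; apply: phom1 Rh.
- by rewrite !rmorphB; apply: phomB Rh _ _ _ _.
- by rewrite !rmorphM; apply: phomM Rh _ _ _ _.
Qed.

Lemma phom_subl (F K : fieldType) (G : F -> Prop) (R : F -> K -> Prop) :
  partial_hom R -> partial_hom (fun (a : gen_ring G) (b : K) => R (val a) b).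
Proof.
move=> Rh; split=> [a b c Rb Rc||a b c d|a b c d].
- exact: (phom_uniq Rh Rb Rc).
- by rewrite !rmorph1; apply: phom1 Rh.
- by rewrite !rmorphB; apply: phomB Rh _ _ _ _.
- by rewrite !rmorphM; apply: phomM Rh _ _ _ _.
Qed.

(** The elements with an image in the target subring are closed under the ring operations, so it
    suffices to treat generators. *)
Lemma phom_extend (F K : fieldType) (G : F -> Prop) (H : K -> Prop)
    (R : F -> K -> Prop) : partial_hom R ->
  (forall x, G x -> exists2 y, R x y & H y) ->
  exists f : {rmorphism gen_ring G -> gen_ring H},
    forall a, R (val a) (val (f a)).
Proof.
move=> Rh RG; apply: (phom_total (phom_sub G H Rh)).
apply: gen_ring_ind => [|u v [u' Ru] [v' Rv]|u v [u' Ru] [v' Rv]|u Gu].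
- by exists 1; rewrite !rmorph1; apply: phom1 Rh.
- by exists (u' - v'); rewrite !rmorphB; apply: phomB Rh _ _ _ _ _ _.
- by exists (u' * v'); rewrite !rmorphM; apply: phomM Rh _ _ _ _ _ _.
have [y Ry Hy] := RG _ Gu.
by exists (GenRing (subring_gen_sub Hy)).
Qed.

(** * Mutation of labelled variables *)

(** Natural exponents keep exchange monomials polynomial, so they can be evaluated where a variable
    is 0. *)
Definition pospart (n : int) : nat := if n is Posz m then m else 0%N.

Lemma pospart_gt0 n : (0 < pospart n)%N = (0 < n).
Proof. by case: n. Qed.

Lemma pospart_eq0 n : (pospart n == 0%N) = (n <= 0).
Proof. by case: n => //= m; lia. Qed.

Section Pattern.
Variables (T : choiceType) (L : {fset T}).
Implicit Types (b : T -> T -> int) (s : seq T).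

Section Field.
Variable K : fieldType.
Implicit Type v : T -> K.

(** The values of [v] lie in any field, so one recursion gives both the cluster variables and their
    values at points. *)
Definition exchange_sum b v k : K :=
  \prod_(t <- L) v t ^+ pospart (b k t) +
  \prod_(t <- L) v t ^+ pospart (- b k t).

Definition pstep b v k : T -> K :=
  fun l => if l == k then (v k)^-1 * exchange_sum b v k else v l.

(* The variable carried by each label after mutations at the labels [s]. *)
Fixpoint pvar b v s : T -> K :=
  if s is k :: s' then pvar (mutate_mx b k) (pstep b v k) s' else v.

Lemma pvar_rcons b v s k :
  pvar b v (rcons s k) = pstep (foldl (@mutate_mx T) b s) (pvar b v s) k.
Proof. by elim: s b v => //= k' s IH b v; rewrite IH. Qed.

Lemma pvar_fixed b v s l : l \notin s -> pvar b v s l = v l.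
Proof.
elim: s b v => //= k s IH b v; rewrite inE negb_or => /andP[lk ls].
by rewrite IH // /pstep (negPf lk).
Qed.

Lemma eq_exchange_sum b v v' k :
  {in L, v =1 v'} -> exchange_sum b v k = exchange_sum b v' k.
Proof.
by move=> vv'; congr (_ + _); rewrite !big_seq; apply: eq_bigr => t tL;
  rewrite vv'.
Qed.

(** Mutation at [k] negates row [k], which only swaps the two monomials. *)
Lemma exchange_sum_mutate b v k :
  exchange_sum (mutate_mx b k) v k = exchange_sum b v k.
Proof.
rewrite /exchange_sum addrC; congr (_ + _); apply: eq_bigr => t _;
  by rewrite /mutate_mx eqxx /= ?opprK.
Qed.

(** As [b k k = 0], the exchange sum does not involve the variable at [k], so it cancels when
    mutating back. *)
Lemma pstepK b v k : b k k = 0 -> v k != 0 -> exchange_sum b v k != 0 ->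
  pstep b (pstep (mutate_mx b k) v k) k = v.
Proof.
move=> bkk vk0 P0; apply/funext => l; rewrite {1}/pstep.
have [->|lk] := eqVneq l k; last by rewrite /pstep (negPf lk).
have -> : exchange_sum b (pstep (mutate_mx b k) v k) k = exchange_sum b v k.
  congr (_ + _); apply: eq_bigr => t _; rewrite /pstep;
    by have [->|//] := eqVneq t k; rewrite bkk ?oppr0 !expr0.
rewrite /pstep eqxx exchange_sum_mutate invfM invrK.
by rewrite -mulrA mulVf ?mulr1.
Qed.

End Field.

(* Evaluation of subtraction-free expressions: at most one label, which is
   never mutated, may have value zero. *)
Section Positivity.
Variable R : realFieldType.
Variable z : option T.
Implicit Type v : T -> R.

Definition nonneg_off v :=
  forall l, l \in L -> 0 <= v l /\ (Some l != z -> 0 < v l).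

Lemma exchange_sum_gt0 b v k : nonneg_off v -> 0 < exchange_sum b v k.
Proof.
move=> v_ge0.
have pr_ge0 (e : T -> nat) : 0 <= \prod_(t <- L) v t ^+ e t.
  by rewrite big_seq prodr_ge0 // => t /v_ge0[? _]; apply: exprn_ge0.
have pr_gt0 (e : T -> nat) : (forall t, Some t == z -> e t = 0%N) ->
    0 < \prod_(t <- L) v t ^+ e t.
  move=> ez; rewrite big_seq; apply: prodr_gt0 => t /v_ge0[_].
  by have [/ez -> _|_ /(_ isT)] := boolP (Some t == z);
    [rewrite expr0 ltr01 | apply: exprn_gt0].
case: z pr_gt0 {v_ge0} => [t0|] pr_gt0; last by rewrite addr_gt0 ?pr_gt0.
(* The entry at [t0] has one sign, so one of the monomials omits [t0] and is positive; the other is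
   nonnegative. *)
have [bneg|bpos] := leP (b k t0) 0.
  by apply: ltr_pwDl => //; apply: pr_gt0 => t /eqP[->]; apply/eqP;
    rewrite pospart_eq0.
apply: ltr_wpDl => //; apply: pr_gt0 => t /eqP[->]; apply/eqP.
by rewrite pospart_eq0; lia.
Qed.

Lemma pstep_nonneg b v k : k \in L -> Some k != z -> nonneg_off v ->
  nonneg_off (pstep b v k).
Proof.
move=> kL kz v_ge0 l lL; rewrite /pstep; case: eqP => // _; last exact: v_ge0.
have /(_ kz) vk := proj2 (v_ge0 k kL).
have P0 : 0 < (v k)^-1 * exchange_sum b v k.
  by rewrite mulr_gt0 ?invr_gt0 // exchange_sum_gt0.
by split=> // ; apply: ltW.
Qed.

Lemma pvar_nonneg b v s : (forall k, k \in s -> k \in L /\ Some k != z) ->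
  nonneg_off v -> nonneg_off (pvar b v s).
Proof.
elim: s b v => //= k s IH b v sL v_ge0.
have [kL kz] := sL k (mem_head _ _).
apply: IH; last exact: pstep_nonneg.
by move=> l ls; apply: sL; rewrite inE ls orbT.
Qed.

End Positivity.

Section Transfer.
Variables (F K : fieldType) (R : F -> K -> Prop).
Hypothesis R_hom : partial_hom R.

Lemma phom_exchange_sum b v w k : (forall l, l \in L -> R (v l) (w l)) ->
  R (exchange_sum b v k) (exchange_sum b w k).
Proof.
by move=> Rvw; apply: phomD => //; apply: phom_prod => // t tL; apply: phomX;
  auto.
Qed.

(** Only the inverse of the mutated variable goes beyond ring operations; nonvanishing on the [w]
    side permits it. *)
Lemma phom_pvar b v w s :
  (forall a c, R a c -> c != 0 -> R a^-1 c^-1) ->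
  (forall l, l \in L -> R (v l) (w l)) -> {subset s <= L} ->
  (forall (s' : seq T) k, {subset s' <= s} -> k \in s -> pvar b w s' k != 0) ->
  forall l, l \in L -> R (pvar b v s l) (pvar b w s l).
Proof.
move=> RV Rvw; elim/last_ind: s => [//|s k IH] sL nz l lL.
have kL : k \in L by apply: sL; rewrite mem_rcons mem_head.
have ssub : {subset s <= rcons s k} by move=> x; rewrite mem_rcons inE orbC => ->.
have {}IH : forall l, l \in L -> R (pvar b v s l) (pvar b w s l).
  by apply: IH => [x /ssub/sL //|s' k' s's k's]; apply: nz => [x /s's|];
    apply: ssub.
rewrite !pvar_rcons /pstep; case: eqP => _; last exact: IH.
apply: phomM => //; last exact: phom_exchange_sum.
by apply: RV; [apply: IH | apply: nz; rewrite // mem_rcons mem_head].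
Qed.

End Transfer.

End Pattern.

(** Mutations are undone from the last to the first; positivity keeps every divisor nonzero. *)
Lemma positive_pattern_reverse (T : choiceType) (L : {fset T})
    (R : realFieldType) b (w : T -> R) s :
  {subset s <= L} -> (forall l, l \in L -> 0 < w l) ->
  (forall (s' : seq T) k, {subset s' <= s} -> k \in s ->
     foldl (@mutate_mx T) b s' k k = 0) ->
  exists2 u : T -> R, (forall l, l \in L -> 0 < u l) & pvar L b u s = w.
Proof.
move=> sL w_gt0.
elim: s b sL => [|k s IH] b sL diag0; first by exists w.
have [|s' j s's js|u u_gt0 us] := IH (mutate_mx b k).
- by move=> x xs; apply: sL; rewrite inE xs orbT.
- apply: (diag0 (k :: s') j) => [x|]; rewrite ?inE ?js ?orbT //.
  by case/orP => [->//|/s's ->]; rewrite orbT.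
have kL : k \in L by apply: sL; rewrite mem_head.
have u_nn : nonneg_off L None u by move=> l lL; split=> [|_]; rewrite ?ltW ?u_gt0.
exists (pstep L (mutate_mx b k) u k).
  by move=> l lL; have [_ ->] := pstep_nonneg (z := None) (mutate_mx b k) kL isT u_nn lL.
rewrite /= pstepK //.
- exact: (diag0 [::] k _ (mem_head _ _)).
- by rewrite gt_eqF ?u_gt0.
- by rewrite gt_eqF // (exchange_sum_gt0 _ _ u_nn).
Qed.

(** * Evaluation of rational functions *)

Lemma intr_eq0_char0 (F : fieldType) (m : int) :
  [pchar F] =i pred0 -> (m%:~R == 0 :> F) = (m == 0).
Proof.
move=> /pcharf0P F0; case: m => n; first exact: (F0 n).
by rewrite /intmul oppr_eq0; exact: (F0 n.+1).
Qed.

Lemma ratr_char0_morphism (F : fieldType) : [pchar F] =i pred0 ->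
  exists r : {rmorphism rat -> F}, ratr = r :> (rat -> F).
Proof.
move=> F0; have int0 m := intr_eq0_char0 m F0.
(* Related numbers share an integer fraction; characteristic 0 lets its denominator be cancelled in
   [F]. *)
pose R (q : rat) (a : F) := exists m n : int,
  [/\ n != 0, q * n%:~R = m%:~R & a * n%:~R = m%:~R].
have Rh : partial_hom R.
  split=> [q a b [m [n [n0 qn an]]] [m' [n' [n'0 qn' bn']]]||
    q a q' a' [m [n [n0 qn an]]] [m' [n' [n'0 qn' an']]]|
    q a q' a' [m [n [n0 qn an]]] [m' [n' [n'0 qn' an']]]].
  - apply: (@mulIf _ (n * n')%:~R); first by rewrite int0 mulf_neq0.
    rewrite !intrM mulrA an [n%:~R * _]mulrC mulrA bn' -!intrM; congr _%:~R.
    by apply: (@intr_inj rat); rewrite !intrM -qn -qn' mulrAC.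
  - by exists 1, 1; rewrite !mulr1.
  - exists (m * n' - m' * n), (n * n'); rewrite mulf_neq0 //.
    split=> //; rewrite rmorphB /= !intrM mulrBl; congr (_ - _);
      first [by rewrite mulrA ?qn ?an | by rewrite mulrCA ?qn' ?an' mulrC].
  - exists (m * m'), (n * n'); rewrite mulf_neq0 //.
    by split=> //; rewrite !intrM mulrACA ?qn ?qn' ?an ?an'.
have [|r _] := phom_total Rh.
  move=> q; exists (ratr q), (numq q), (denq q); rewrite denq_neq0.
  by rewrite /ratr divfK ?int0 ?denq_neq0 // -numqE.
by exists r; apply/funext => q; rewrite fmorph_eq_rat.
Qed.

Section Specialization.
Variables (F K : fieldType) (S : {fset F}) (phi : F -> K).

Definition mp_eval (E : fieldType) (h : F -> E) (p : {mpoly rat[#|` S|]}) : E :=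
  mmap (ratr : rat -> E) (fun i => h (enum_fset S)`_i) p.

(** Graph of evaluation at the point [phi] of the rational functions [p / q] regular there. When [S]
    is independent, nonvanishing of [q] at [phi] makes it nonzero in [F] too, so [a] is the
    quotient. *)
Definition specialization (a : F) (c : K) : Prop :=
  exists p q, [/\ mp_eval phi q != 0, a * mp_eval id q = mp_eval id p
                & c * mp_eval phi q = mp_eval phi p].

Hypotheses (F0 : [pchar F] =i pred0) (K0 : [pchar K] =i pred0).

Lemma mp_eval_morphism (E : fieldType) (h : F -> E) : [pchar E] =i pred0 ->
  exists e : {rmorphism {mpoly rat[#|` S|]} -> E}, mp_eval h = e.
Proof.
move=> /ratr_char0_morphism[r rE]; rewrite /mp_eval rE.
by exists (mmap r (fun i => h (enum_fset S)`_i)).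
Qed.

Lemma mp_evalX (E : fieldType) (h : F -> E) x : [pchar E] =i pred0 -> x \in S ->
  exists p, mp_eval h p = h x /\ mp_eval id p = x.
Proof.
move=> E0 xS; have [r rE] := ratr_char0_morphism E0.
have [r' rE'] := ratr_char0_morphism F0.
have ltxS : (index x (enum_fset S) < #|` S|)%N by rewrite index_mem.
exists 'X_(Ordinal ltxS); rewrite /mp_eval rE rE' !mmapX !mmap1U /=.
by rewrite !nth_index.
Qed.

Lemma mp_evalC (E : fieldType) (h : F -> E) c : [pchar E] =i pred0 ->
  mp_eval h c%:MP = ratr c.
Proof. by move=> /ratr_char0_morphism[r rE]; rewrite /mp_eval rE mmapC. Qed.

Lemma specialization_gen x : x \in S -> specialization x (phi x).
Proof.
move=> xS; have [p [pK pF]] := mp_evalX phi K0 xS.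
exists p, 1; have [ek ekE] := mp_eval_morphism phi K0.
have [ef efE] := mp_eval_morphism id F0.
by rewrite pK pF ekE efE !rmorph1 !mulr1 oner_neq0.
Qed.

Lemma specialization_rat c : specialization (ratr c) (ratr c).
Proof.
exists c%:MP, 1%:MP; rewrite !mp_evalC //.
by rewrite !(ratr_nat _ 1) !mulr1 oner_neq0.
Qed.

Hypothesis S_free : alg_independent S.

Lemma mp_eval_eq0 p : mp_eval id p = 0 -> p = 0.
Proof. exact: S_free. Qed.

Lemma specialization_inv a c : specialization a c -> c != 0 ->
  specialization a^-1 c^-1.
Proof.
move=> [p [q [q0 ap cp]]] c0; exists q, p.
have p0 : mp_eval phi p != 0 by rewrite -cp mulf_neq0.
split=> //; last by rewrite -cp mulKf.
suff a0 : a != 0 by rewrite -ap mulKf.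
apply: contraNneq p0 => a0; move: ap; rewrite a0 mul0r => /esym/mp_eval_eq0 ->.
by have [ek ->] := mp_eval_morphism phi K0; rewrite rmorph0.
Qed.

Lemma specialization_hom : partial_hom specialization.
Proof.
have [ek ekE] := mp_eval_morphism phi K0.
have [ef efE] := mp_eval_morphism id F0.
split=> [a b c [p [q [q0 ap bp]]] [p' [q' [q'0 ap' cp']]]||
  a b c d [p [q [q0 ap bp]]] [p' [q' [q'0 cp' dp']]]|
  a b c d [p [q [q0 ap bp]]] [p' [q' [q'0 cp' dp']]]].
(* Independence turns equality of the fractions in [F] into a polynomial identity, which survives
   evaluation. *)
- have pq : p * q' = p' * q.
    apply/eqP; rewrite -subr_eq0; apply/eqP/mp_eval_eq0.
    by rewrite efE rmorphB !rmorphM -efE /= -ap -ap' mulrAC subrr.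
  apply: (mulIf (mulf_neq0 q0 q'0)).
  by rewrite mulrA bp mulrCA cp' ekE -!rmorphM pq mulrC.
- by exists 1, 1; rewrite ekE efE !rmorph1 !mulr1 oner_neq0.
- exists (p * q' - p' * q), (q * q').
  rewrite efE ekE !rmorphB !rmorphM -efE -ekE mulf_neq0 //=.
  by split=> //; rewrite -?ap -?bp -?cp' -?dp' mulrBl; congr (_ - _);
    first [by rewrite mulrA | by rewrite mulrCA mulrC].
exists (p * p'), (q * q').
rewrite efE ekE !rmorphM -efE -ekE mulf_neq0 //=.
by split=> //; rewrite mulrACA ?ap ?bp ?cp' ?dp'.
Qed.

End Specialization.

Lemma rmorph_mmap (n : nat) (A : nzRingType) (B C : comNzRingType)
    (g : {rmorphism B -> C}) (r : A -> B) (h : 'I_n -> B) p :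
  g (mmap r h p) = mmap (g \o r) (g \o h) p.
Proof.
rewrite /mmap rmorph_sum; apply: eq_bigr => m _; rewrite rmorphM /=.
by rewrite /mmap1 rmorph_prod; congr (_ * _); apply: eq_bigr => i _;
  rewrite rmorphXn.
Qed.

Lemma eq_mmap (n : nat) (A B : nzRingType) (r r' : A -> B) (h h' : 'I_n -> B) p :
  r =1 r' -> h =1 h' -> mmap r h p = mmap r' h' p.
Proof. by move=> /funext -> /funext ->. Qed.

(** A relation over [S'] is renamed along [f] into one over [S], hence trivial there; injectivity of
    [f] makes the renaming reversible. *)
Lemma alg_independent_sub (F K : fieldType) (f : {rmorphism K -> F})
    (S : {fset F}) (S' : {fset K}) : [pchar F] =i pred0 -> alg_independent S ->
  {subset [fset f x | x in S'] <= S} -> alg_independent S'.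
Proof.
move=> F0 S_free subS p.
pose x' i := (enum_fset S')`_i; pose x i := (enum_fset S)`_i.
have [r rE] := ratr_char0_morphism F0.
have fS (i : 'I_#|` S'|) : (index (f (x' i)) (enum_fset S) < #|` S|)%N.
  by rewrite index_mem; apply/subS/imfsetP; exists (x' i); rewrite //= mem_nth.
pose q := mmap (@mpolyC _ rat) (fun i => 'X_(Ordinal (fS i))) p.
(* [h] undoes the renaming [q]; variables outside the image go to the empty sum 0. *)
pose h j := \sum_(i < #|` S'| | f (x' i) == x j) ('X_i : {mpoly rat[#|` S'|]}).
have qp : mmap (@mpolyC _ rat) (fun j : 'I_#|` S| => h j) q = p.
  rewrite /q rmorph_mmap -[RHS]comp_mpoly_id /comp_mpoly.
  apply: eq_mmap => [c|i] /=; first by rewrite mmapC.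
  rewrite mmapX mmap1U tnth_mktuple /h (big_pred1 i) // => j /=.
  rewrite /x nth_index; last by rewrite -index_mem; apply: fS.
  rewrite (inj_eq (fmorph_inj f)) /x' nth_uniq //; exact: fset_uniq.
move=> p0; rewrite -qp (S_free q) ?raddf0 //.
suff -> : mmap (@ratr F) (fun i => x i) q =
    f (mmap (@ratr K) (fun i => x' i) p) by rewrite p0 rmorph0.
rewrite rE /q !rmorph_mmap; apply: eq_mmap => [c|i] /=.
  by rewrite mmapC fmorph_rat rE.
rewrite mmapX mmap1U /x nth_index // -index_mem; exact: fS.
Qed.

(** * Seeds with variables labelled by the initial extended cluster *)

Lemma prod_imfset (R : comPzSemiRingType) (I J : choiceType) (h : I -> J)
    (A : {fset I}) (G : J -> R) : {in A &, injective h} ->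
  \prod_(j <- [fset h i | i in A]) G j = \prod_(i <- A) G (h i).
Proof. by move=> h_inj; rewrite big_imfset. Qed.

Section Labelled.
Variables (F : fieldType) (D0 : seed_data F).
Hypothesis D0_disj : [disjoint exch D0 & froz D0]%fset.
Implicit Types (D : seed_data F) (b : F -> F -> int) (v : F -> F) (s : seq F).

Let X := exch D0.
Let L := ext D0.

(** Label [l] carries the variable [v l]. As [b] is indexed by labels, it mutates without the
    renaming of indices done in [mutate]. *)
Record labelled D b v : Prop := Labelled {
  lab_inj : {in L &, injective v};
  lab_froz : {in froz D0, v =1 id};
  lab_exchE : exch D = [fset v x | x in X];
  lab_frozE : froz D = froz D0;
  lab_bmx : forall x l, x \in X -> l \in L -> bmx D (v x) (v l) = b x l
}.

Lemma exch_ext x : x \in X -> x \in L.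
Proof. by rewrite inE => ->. Qed.

Lemma froz_ext x : x \in froz D0 -> x \in L.
Proof. by rewrite inE orbC => ->. Qed.

Lemma lab_ext D b v : labelled D b v -> ext D = [fset v l | l in L].
Proof.
move=> Dl; apply/fsetP => a; rewrite inE (lab_exchE Dl) (lab_frozE Dl).
apply/orP/imfsetP => [[/imfsetP[x /= xX ->]|aY]|[l /= ]].
- by exists x; rewrite //= exch_ext.
- by exists a; rewrite /= ?froz_ext // (lab_froz Dl).
rewrite inE => /orP[lX|lY] ->; last by right; rewrite (lab_froz Dl).
by left; apply/imfsetP; exists l.
Qed.

Lemma exchange_labelled D b v k : labelled D b v -> k \in X ->
  exchange D (v k) = (v k)^-1 * exchange_sum L b v k.
Proof.
move=> Dl kX; rewrite /exchange (lab_ext Dl).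
have v_inj := lab_inj Dl; have bE l := lab_bmx Dl (l := l) kX.
rewrite big_mkcond [X in _ + X]big_mkcond /= !prod_imfset //.
congr (_ * (_ + _)); rewrite big_seq [RHS]big_seq; apply: eq_bigr => t /bE ->;
  by case: (b k t) => [[|n]|n].
Qed.

Lemma labelled_mutate D b v k : labelled D b v -> k \in X ->
  {in L &, injective (pstep L b v k)} ->
  labelled (mutate D (v k)) (mutate_mx b k) (pstep L b v k) /\
  {in L, forall l, mutate_var D (v k) (v l) = pstep L b v k l}.
Proof.
move=> Dl kX v'_inj; have v_inj := lab_inj Dl; have kL := exch_ext kX.
have ex := exchange_labelled Dl kX; set v' := pstep L b v k.
have v'k : v' k = exchange D (v k) by rewrite /v' /pstep eqxx ex.
have v'n l : l != k -> v' l = v l by rewrite /v' /pstep => /negPf ->.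
split; last first.
  move=> l lL; rewrite /mutate_var (inj_in_eq v_inj) //.
  by case: eqVneq => [->|/v'n ->].
have eXk (y : F) : (v' y == exchange D (v k)) = (v' y == v' k) by rewrite v'k.
(* Distinctness of the new variables lets the index translation in [mutate] recover the old variable
   of each label. *)
have oldE y : y \in L ->
    (if v' y == exchange D (v k) then v k else v' y) = v y.
  by move=> yL; rewrite eXk (inj_in_eq v'_inj) //; case: eqVneq => [->|/v'n].
split=> //=.
- move=> l lY; rewrite v'n ?(lab_froz Dl) //.
  apply: contraTneq lY => ->.
  by move: kX; apply: fdisjointP.
- apply/fsetP => a; rewrite in_fset1U in_fsetD1 (lab_exchE Dl) -v'k.
  apply/orP/imfsetP => [[/eqP ->|/andP[ak /imfsetP[x /= xX ax]]]|[x /= xX ->]].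
  + by exists k.
  + by exists x; rewrite // v'n //; apply: contraNneq ak => <-; rewrite ax.
  have [->|xk] := eqVneq x k; [by left | right]; rewrite v'n //.
  by rewrite (inj_in_eq v_inj) ?exch_ext // xk in_imfset.
- exact: lab_frozE Dl.
move=> x l xX lL; have xL := exch_ext xX; rewrite !oldE // /mutate_mx.
by rewrite !(inj_in_eq v_inj) // !(lab_bmx Dl).
Qed.

(* The variables mutated successively along the labels [s]. *)
Fixpoint pseq b v s : seq F :=
  if s is k :: s' then v k :: pseq (mutate_mx b k) (pstep L b v k) s' else [::].

Lemma pseq_rcons b v s k : pseq b v (rcons s k) = rcons (pseq b v s) (pvar L b v s k).
Proof. by elim: s b v => //= k' s IH b v; rewrite IH. Qed.

Section Mutable.
Variables (b : F -> F -> int) (v : F -> F) (D : seed_data F).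
Hypothesis Dl : labelled D b v.
Hypothesis D_inj : forall s, {subset s <= X} -> {in L &, injective (pvar L b v s)}.

Lemma labelled_mutate_seq s : {subset s <= X} ->
  [/\ admissible D (pseq b v s),
      labelled (mutate_seq D (pseq b v s)) (foldl (@mutate_mx F) b s) (pvar L b v s)
    & {in L, forall l, mutate_var_seq D (pseq b v s) (v l) = pvar L b v s l}].
Proof.
elim: s b v D Dl D_inj => [|k s IH] b' v' D' Dl' D_inj' //= ksX.
have kX : k \in X by apply: ksX; rewrite mem_head.
have sX : {subset s <= X} by move=> x xs; apply: ksX; rewrite inE xs orbT.
have [|Dl1 mE] := labelled_mutate Dl' kX.
  by apply: (D_inj' [:: k]) => x; rewrite inE => /eqP ->.
have [|A1 A2 A3] := IH _ _ _ Dl1 _ sX.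
  move=> s' s'X; apply: (D_inj' (k :: s')) => x.
  by rewrite inE => /orP[/eqP ->|/s'X].
rewrite A1 (lab_exchE Dl') in_imfset //=; split=> // l lL.
by rewrite mE ?A3.
Qed.

End Mutable.

Lemma admissible_labelled b v D s : labelled D b v ->
  (forall s, {subset s <= X} -> {in L &, injective (pvar L b v s)}) ->
  admissible D s -> exists2 s0, {subset s0 <= X} & s = pseq b v s0.
Proof.
elim: s b v D => [|y s IH] b v D Dl D_inj /=; first by exists [::].
rewrite (lab_exchE Dl) => /andP[/imfsetP[k /= kX ->]] adm.
have [|Dl1 mE] := labelled_mutate Dl kX.
  by apply: (D_inj [:: k]) => x; rewrite inE => /eqP ->.
have [|s0 s0X ->] := IH _ _ _ Dl1 _ adm.
  move=> s' s'X; apply: (D_inj (k :: s')) => x.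
  by rewrite inE => /orP[/eqP ->|/s'X].
by exists (k :: s0) => // x; rewrite inE => /orP[/eqP ->|/s0X].
Qed.

End Labelled.

(** * Variables and matrices of the seeds mutated from a fixed seed *)

Section SeedPattern.
Variable S : seed.
Let F := seed_field S.
Let D := seed_of S.
Let X := cluster S.
Let L := xcluster S.
Let b0 := bmx D.
Implicit Types (s : seq F) (k l x : F).

(* Labels are the initial variables themselves. *)
Definition svar s : F -> F := pvar L b0 id s.
Definition sseq s : seq F := pseq D b0 id s.
Definition smx s := foldl (@mutate_mx F) b0 s.

Lemma cluster_sub : {subset X <= L}.
Proof. exact: exch_ext. Qed.

Lemma frozen_sub : {subset frozen S <= L}.
Proof. exact: froz_ext. Qed.

Lemma frozenE l : l \in L -> (l \in frozen S) = (l \notin X).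
Proof.
have disj := seed_disjoint (seedP S); case/fsetUP => [lX|lY].
  by rewrite [RHS](negbF lX); apply/negbTE; apply: (fdisjointP disj).
by rewrite [LHS]lY; apply/esym; apply: (fdisjointP_sym disj).
Qed.

Lemma smx_diag s k : {subset s <= X} -> k \in X -> smx s k k = 0.
Proof.
move=> sX kX; have [[]//|] := seed_tsss (seedP S) sX kX kX.
by rewrite -expr2 ltNge sqr_ge0.
Qed.

Lemma place_rat (u : F -> rat) :
  partial_hom (specialization L u).
Proof.
apply: specialization_hom; [exact: seed_char0 (seedP S)| exact: pchar_num|].
exact: seed_independent (seedP S).
Qed.

Lemma svar_specialization (K : fieldType) (phi : F -> K) s :
  [pchar K] =i pred0 -> {subset s <= X} ->
  (forall s' k, {subset s' <= s} -> k \in s -> pvar L b0 phi s' k != 0) ->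
  forall l, l \in L -> specialization L phi (svar s l) (pvar L b0 phi s l).
Proof.
move=> K0 sX nz l lL; have F0 := seed_char0 (seedP S).
have Lfree := seed_independent (seedP S).
apply: phom_pvar => //.
- exact: specialization_hom.
- by move=> a c; apply: specialization_inv.
- by move=> k kL; apply: specialization_gen.
- by move=> k /sX/cluster_sub.
Qed.

(** Mutated labels differ from [z] and keep positive values, so no divisor vanishes and evaluation
    commutes with mutation. *)
Lemma svar_place z (u : F -> rat) s : nonneg_off L z u -> {subset s <= X} ->
  (forall k, k \in s -> Some k != z) ->
  nonneg_off L z (pvar L b0 u s) /\
  (forall l, l \in L -> specialization L u (svar s l) (pvar L b0 u s l)).
Proof.
move=> u_nn sX sz.
have pos s' : {subset s' <= s} -> nonneg_off L z (pvar L b0 u s').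
  move=> s's; apply: pvar_nonneg => // k /s's ks.
  by split; [apply/cluster_sub/sX | apply: sz].
split; first exact: pos.
apply: svar_specialization => // [|s' k s's ks]; first exact: pchar_num.
have kL := cluster_sub (sX _ ks).
by have [_ /(_ (sz _ ks)) /gt_eqF ->] := pos _ s's _ kL.
Qed.

Lemma positive_nonneg_off (u : F -> rat) :
  (forall l, l \in L -> 0 < u l) -> nonneg_off L None u.
Proof. by move=> u0 l /u0 ul; split=> //; apply: ltW. Qed.

(* Running the mutations backwards from a positive point [w] gives initial
   values for which the mutated variables take the values prescribed by [w]. *)
Lemma svar_place_surj (w : F -> rat) s : {subset s <= X} ->
  (forall l, l \in L -> 0 < w l) ->
  exists u, forall l, l \in L -> specialization L u (svar s l) (w l).
Proof.
move=> sX w0; have sL k : k \in s -> k \in L by move=> /sX/cluster_sub.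
have [|u u0 us] := positive_pattern_reverse (b := b0) sL w0.
  by move=> s' k s's ks; apply: smx_diag => [j /s's/sX|]; last exact: sX.
exists u => l lL; rewrite -us.
by have [_] := svar_place (positive_nonneg_off u0) sX (fun _ _ => isT); apply.
Qed.

(** Some point gives the mutated variables the value 1 at [l1] and 2 at all other labels. *)
Lemma svar_inj s : {subset s <= X} -> {in L &, injective (svar s)}.
Proof.
move=> sX l1 l2 l1L l2L e; apply/eqP/contraT => l12.
have [|u us] := svar_place_surj (w := fun l => if l == l1 then 1 else 2) sX.
  by move=> l _; case: ifP.
have := us _ l2L; rewrite eq_sym (negPf l12) -e => e2.
by have := phom_uniq (place_rat u) (us _ l1L) e2; rewrite eqxx.
Qed.

Lemma svar_neq0 s l : {subset s <= X} -> l \in L -> svar s l != 0.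
Proof.
move=> sX lL; apply/eqP => e.
have [//|u /(_ l lL)] := svar_place_surj (w := fun=> 1) sX.
by rewrite e => /(phom_uniq (place_rat u) (phom0 (place_rat u))).
Qed.

(** Where all initial variables are 1, the mutated variable is 1 + 1 = 2. *)
Lemma svar1_neq k : k \in X -> svar [:: k] k != k.
Proof.
move=> kX; apply/eqP => e; have kL := cluster_sub kX.
have kX1 : {subset [:: k] <= X} by move=> x; rewrite inE => /eqP ->.
have u_nn : nonneg_off L None (fun=> 1 : rat) by [].
have k_spec : specialization L (fun=> 1 : rat) k 1.
  by apply: specialization_gen => //; [exact: seed_char0 (seedP S) | exact: pchar_num].
have [_ /(_ k kL)] := svar_place u_nn kX1 (fun _ _ => isT).
rewrite e => /(phom_uniq (place_rat _) k_spec).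
rewrite /= /pstep eqxx /exchange_sum invr1 mul1r.
by rewrite !big1 // => t _; rewrite /= expr1n.
Qed.

Lemma svar_rcons s k l : svar (rcons s k) l =
  if l == k then (svar s k)^-1 * exchange_sum L (smx s) (svar s) k
  else svar s l.
Proof. by rewrite /svar pvar_rcons. Qed.

Lemma svar_frozen s l : {subset s <= X} -> l \in frozen S -> svar s l = l.
Proof.
move=> sX lY; rewrite /svar pvar_fixed //; apply: contraTN lY => /sX lX.
by have := fdisjointP (seed_disjoint (seedP S)) _ lX.
Qed.

Lemma labelled_id : labelled D D b0 id.
Proof.
split=> //; by apply/fsetP => a; rewrite imfset_id.
Qed.

Lemma sseqP s : {subset s <= X} ->
  [/\ admissible D (sseq s), labelled D (mutate_seq D (sseq s)) (smx s) (svar s)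
    & {in L, forall l, mutate_var_seq D (sseq s) l = svar s l}].
Proof.
exact: labelled_mutate_seq (seed_disjoint (seedP S)) _ _ _ labelled_id svar_inj _.
Qed.

Lemma admissible_sseq s : admissible D s ->
  exists2 s0, {subset s0 <= X} & s = sseq s0.
Proof.
exact: (admissible_labelled (seed_disjoint (seedP S)) labelled_id svar_inj).
Qed.

Definition generator x : Prop :=
  x \in frozen S \/ cluster_variable (seed_of S) x.

Lemma generatorP x : generator x <->
  exists s l, [/\ {subset s <= X}, l \in L & x = svar s l].
Proof.
split=> [[xY|[s /admissible_sseq[s0 s0X ->]]]|[s [l [sX lL ->]]]].
- by exists [::], x; split=> //; apply: frozen_sub.
- have [_ Dl _] := sseqP s0X; rewrite (lab_exchE Dl) => /imfsetP[k /= kX ->].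
  by exists s0, k; split=> //; apply: cluster_sub.
have [lX|lY] := boolP (l \in X); last first.
  by left; rewrite svar_frozen ?frozenE.
have [adm Dl _] := sseqP sX; right; exists (sseq s) => //.
by rewrite (lab_exchE Dl) in_imfset.
Qed.

(* Elements of the field outside the cluster algebra are sent to 0. *)
Definition alg_lift (a : F) : cluster_algebra S := insubd 0 a.

Lemma alg_lift_svar s l : {subset s <= X} -> l \in L ->
  val (alg_lift (svar s l)) = svar s l.
Proof.
move=> sX lL; rewrite val_insubd subring_gen_sub //.
by apply/generatorP; exists s, l.
Qed.

Lemma alg_liftK l : l \in L -> val (alg_lift l) = l.
Proof. by apply: (alg_lift_svar (s := [::])). Qed.

Lemma alg_lift_val u : alg_lift (val u) = u.
Proof. exact: valKd. Qed.

Lemma alg_lift_sseq s : {subset s <= X} ->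
  [seq val (alg_lift y) | y <- sseq s] = sseq s.
Proof.
elim/last_ind: s => [//|s k IH] skX.
have kX : k \in X by apply: skX; rewrite mem_rcons mem_head.
have sX : {subset s <= X} by move=> x xs; apply: skX; rewrite mem_rcons inE xs orbT.
rewrite /sseq pseq_rcons map_rcons [map _ _]IH //; congr rcons.
by apply: alg_lift_svar => //; apply: cluster_sub.
Qed.

Lemma cluster_alg_ind (P : cluster_algebra S -> Prop) :
  P 1 -> (forall u v, P u -> P v -> P (u - v)) ->
  (forall u v, P u -> P v -> P (u * v)) ->
  (forall s l, {subset s <= X} -> l \in L -> P (alg_lift (svar s l))) ->
  forall u, P u.
Proof.
move=> P1 PB PM Pg; apply: gen_ring_ind => // u /generatorP[s [l [sX lL e]]].
by rewrite -[u]alg_lift_val e; apply: Pg.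
Qed.

End SeedPattern.
(** * Noncontractible rooted cluster morphisms *)

Lemma sub_rcons (T : eqType) (q : {pred T}) (s : seq T) (k : T) :
  {subset rcons s k <= q} -> {subset s <= q} /\ k \in q.
Proof.
move=> skq; split=> [x xs|]; apply: skq; rewrite mem_rcons ?mem_head //.
by rewrite inE xs orbT.
Qed.

Section NoncontractibleMorphism.
Variables S S' : seed.
Variable f : {rmorphism cluster_algebra S -> cluster_algebra S'}.
Hypothesis f_morph : rooted_cluster_morphism f.
Hypothesis f_noncontr : noncontractible f.
Let L := xcluster S.
Let L' := xcluster S'.
Implicit Types (s : seq (seed_field S)) (k l : seed_field S).

(** [f] as a map of ambient fields, meaningful on the cluster algebra; elsewhere [alg_lift] makes it
    0. *)
Definition img (a : seed_field S) : seed_field S' := val (f (alg_lift a)).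

Lemma img_xcluster l : l \in L -> img l \in L'.
Proof.
move=> lL; have vl := alg_liftK lL.
by have [||/f_noncontr[]] := @rcm_ext _ _ _ f_morph (alg_lift l); rewrite ?vl.
Qed.

Lemma img_cluster k : k \in cluster S -> img k \in cluster S'.
Proof.
move=> kX; have kL := cluster_sub kX; have vk := alg_liftK kL.
by have [||/f_noncontr[]] := @rcm_exch _ _ _ f_morph (alg_lift k); rewrite ?vk.
Qed.

Lemma img_seq s : {subset s <= cluster S} ->
  {subset map img s <= cluster S'}.
Proof. by move=> sX _ /mapP[k /sX kX ->]; apply: img_cluster. Qed.

(** Both parts are proved together: [rcm_mutation] applies once the images of the mutated variables
    are known to form an admissible sequence, and the second part for shorter sequences computes
    these images. *)
Lemma img_svar s : {subset s <= cluster S} ->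
  [seq img y | y <- sseq s] = sseq (map img s) /\
  {in L, forall l, img (svar s l) = svar (map img s) (img l)}.
Proof.
elim/last_ind: s => [//|s k IH] skX.
have [sX kX] := sub_rcons skX; have [IHs IHv] := IH sX.
have kL := cluster_sub kX.
have e : [seq img y | y <- sseq (rcons s k)] = sseq (map img (rcons s k)).
  by rewrite map_rcons /sseq !pseq_rcons map_rcons -[in RHS]/(sseq _) -IHs
    -[pvar _ _ _ _ _]/(svar s k) IHv.
split=> // l lL; set us := [seq alg_lift y | y <- sseq (rcons s k)].
have us1 : [seq val u | u <- us] = sseq (rcons s k).
  by rewrite -map_comp alg_lift_sseq.
have us2 : [seq val (f u) | u <- us] = sseq (map img (rcons s k)).
  by rewrite -e -map_comp.
have [adm _ mut] := sseqP skX; have [adm' _ mut'] := sseqP (img_seq skX).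
have := rcm_mutation f_morph (s := us) (y := alg_lift l)
  (z := alg_lift (svar (rcons s k) l)).
rewrite /biadmissible us1 us2 adm adm' alg_liftK // alg_lift_svar // mut //.
by rewrite mut' ?img_xcluster //; apply.
Qed.

(** Mutation at [k] fixes a different [l], hence the common image, whereas mutation at [img k]
    changes [img k]. *)
Lemma img_inj_cluster k l : k \in cluster S -> l \in L -> img k = img l -> k = l.
Proof.
move=> kX lL kl; apply/eqP/contraT => nkl.
have kX1 : {subset [:: k] <= cluster S} by move=> x; rewrite inE => /eqP ->.
have [_ /(_ l lL)] := img_svar kX1.
rewrite /svar pvar_fixed; last by rewrite inE eq_sym.
rewrite -kl => /esym/eqP; rewrite -[pvar _ _ _ _ _]/(svar [:: img k] (img k)).
by rewrite (negPf (svar1_neq (img_cluster kX))).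
Qed.

Definition img_graph a c : Prop :=
  exists2 u : cluster_algebra S, val u = a & val (f u) = c.

Lemma img_graph_svar s l : {subset s <= cluster S} -> l \in L ->
  img_graph (svar s l) (svar (map img s) (img l)).
Proof.
move=> sX lL; exists (alg_lift (svar s l)); first by rewrite alg_lift_svar.
by have [_ <-] := img_svar sX.
Qed.

Lemma phom_img : partial_hom img_graph.
Proof.
split=> [a b c [u <- <-] [v /val_inj -> <-] //||
  _ _ _ _ [u <- <-] [v <- <-]|_ _ _ _ [u <- <-] [v <- <-]].
- by exists 1; rewrite ?rmorph1.
- by exists (u - v); rewrite !rmorphB.
- by exists (u * v); rewrite !rmorphM.
Qed.

Lemma svar_img_neq0 s l : {subset s <= cluster S} -> l \in L ->
  svar (map img s) (img l) != 0.
Proof. by move=> sX lL; apply: svar_neq0 (img_seq sX) (img_xcluster lL). Qed.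

(* The left side mutates with the matrix of [S'], the right side with that
   of [S]. *)
Lemma svar_img s l : {subset s <= cluster S} -> l \in L ->
  svar (map img s) (img l) = pvar L (bmx (seed_of S)) img s l.
Proof.
elim/last_ind: s l => [//|s k IH] l skX lL.
have [sX kX] := sub_rcons skX; have kL := cluster_sub kX.
rewrite pvar_rcons /pstep; case: eqVneq => [{l lL}->|lk]; last first.
  rewrite -IH //; have [_ <-//] := img_svar sX; have [_ <-//] := img_svar skX.
  by rewrite svar_rcons (negPf lk).
have k0 := svar_img_neq0 sX kL; rewrite -IH //.
apply: (canRL (mulKf k0)); rewrite -(eq_exchange_sum _ _ (fun l => IH l sX)).
(* Both sides are images under [f] of one element: the exchange relation of [S] with the denominator
   cleared. *)
apply: (phom_uniq phom_img (a := svar s k * svar (rcons s k) k)).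
  by apply: phomM phom_img _ _ _ _ _ _; apply: img_graph_svar.
rewrite svar_rcons eqxx mulVKf ?svar_neq0 //.
by apply: phom_exchange_sum phom_img _ _ _ _ _ => j jL; apply: img_graph_svar.
Qed.

Lemma img_coherent s k l1 l2 : {subset s <= cluster S} -> k \in cluster S ->
  l1 \in L -> l2 \in L -> img l1 = img l2 ->
  ~ (0 < smx s k l1 /\ smx s k l2 < 0).
Proof.
move=> sX kX l1L l2L l12 [b1 b2].
(* An exchangeable [l1] would equal [l2], against the opposite signs. *)
have [l1k|l1X] := boolP (l1 \in cluster S).
  by move: b1 b2; rewrite (img_inj_cluster l1k l2L l12); lia.
(* Evaluating the exchange relation at [img l1 = 0] and all other initial
   variables equal to 1, both monomials of [S] vanish while the mutated
   variable is positive. *)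
pose u x : rat := if x == img l1 then 0 else 1.
have nz j : j \in cluster S -> Some (img j) != Some (img l1).
  by move=> jX; apply: contraNneq l1X => -[/(img_inj_cluster jX l1L) <-].
have u_nn : nonneg_off L' (Some (img l1)) u.
  by move=> x _; rewrite /u; case: eqVneq => [->|_]; rewrite ?eqxx.
have skX : {subset rcons s k <= cluster S}.
  by move=> x; rewrite mem_rcons inE => /orP[/eqP ->|/sX].
have place (t : seq (seed_field S)) : {subset t <= cluster S} ->
    nonneg_off L' (Some (img l1)) (pvar L' (bmx (seed_of S')) u (map img t)) /\
    forall x, x \in L' -> specialization L' u (svar (map img t) x)
      (pvar L' (bmx (seed_of S')) u (map img t) x).
  move=> tX; apply: svar_place u_nn (img_seq tX) _ => _ /mapP[j /tX jX ->].
  exact: nz.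
have Rh := place_rat u; have kL := cluster_sub kX.
have [pos_sk spec_sk] := place _ skX; have [pos_s spec_s] := place _ sX.
have kL' := img_xcluster kL.
have := phomM Rh (spec_s _ kL') (spec_sk _ kL').
set c := (X in specialization _ _ _ X).
have c_gt0 : 0 < c.
  have [_ /(_ (nz _ kX)) p1] := pos_s _ kL'.
  by have [_ /(_ (nz _ kX)) p2] := pos_sk _ kL'; rewrite mulr_gt0.
(* By [svar_img], the exchange relation of [S] holds between the image variables. *)
have -> : svar (map img s) (img k) * svar (map img (rcons s k)) (img k) =
    exchange_sum L (smx s) (svar (map img s) \o img) k.
  rewrite [X in _ * X]svar_img // pvar_rcons /pstep eqxx -svar_img //.
  rewrite mulVKf ?svar_img_neq0 //; apply: eq_exchange_sum => l lL /=.
  by rewrite svar_img.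
have l1_0 : specialization L' u (svar (map img s) (img l1)) 0.
  have := spec_s _ (img_xcluster l1L).
  rewrite pvar_fixed; first by rewrite /u eqxx.
  by apply/negP => /mapP[j /sX/nz jX e]; rewrite e eqxx in jX.
have e_0 : specialization L' u
    (exchange_sum L (smx s) (svar (map img s) \o img) k) 0.
  have prod0 (e : seed_field S -> nat) l : l \in L -> img l = img l1 ->
      (0 < e l)%N -> specialization L' u
        (\prod_(t <- L) (svar (map img s) \o img) t ^+ e t) 0.
    move=> lL le el; pose w t := pvar L' (bmx (seed_of S')) u (map img s) (img t).
    have -> : 0 = \prod_(t <- L) w t ^+ e t.
      rewrite (big_fsetD1 l) //= (_ : w l = 0) ?expr0n ?gtn_eqF ?mul0r //.
      by apply: (phom_uniq Rh) l1_0; rewrite -le; apply/spec_s/img_xcluster.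
    by apply: phom_prod => // t tL; apply: phomX => //; apply/spec_s/img_xcluster.
  rewrite -[0]addr0; apply: phomD => //.
    by apply: (prod0 _ l1); rewrite // pospart_gt0.
  by apply: (prod0 _ l2); rewrite // pospart_gt0 oppr_gt0.
by move=> /(phom_uniq Rh e_0) c0; rewrite -c0 ltxx in c_gt0.
Qed.

Hypothesis f_surj : surjective_map f.

(** Surjectivity makes every element of the target an integer polynomial in the images of the
    generators. *)
Lemma surjective_phom_total (C : comPzRingType) (R : seed_field S' -> C -> Prop) :
  partial_hom R ->
  (forall s l, {subset s <= cluster S} -> l \in L ->
     exists c, R (svar (map img s) (img l)) c) ->
  forall a' : cluster_algebra S', exists c, R (val a') c.
Proof.
move=> Rh Rgen a'; have [a <-] := f_surj a'; elim/cluster_alg_ind: a => //.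
- by exists 1; rewrite !rmorph1; apply: phom1 Rh.
- move=> u v [c Ru] [d Rv]; exists (c - d).
  by rewrite !rmorphB; apply: phomB Rh _ _ _ _ _ _.
- move=> u v [c Ru] [d Rv]; exists (c * d).
  by rewrite !rmorphM; apply: phomM Rh _ _ _ _ _ _.
move=> s l sX lL; have [_ /(_ l lL) e] := img_svar sX.
by rewrite -[val _]/(img (svar s l)) e; apply: Rgen.
Qed.

Lemma img_xcluster_surj z : z \in L' -> exists2 l, l \in L & img l = z.
Proof.
move=> zL; apply: contrapT => nz.
(* The two points differ only at the supposedly missed [z]; [R] describes the elements with equal
   values at both. *)
pose u1 (x : seed_field S') : rat := 1; pose u2 x : rat := if x == z then 2 else 1.
have Rh1 := place_rat u1; have Rh2 := place_rat u2.
pose R a c := specialization L' u1 a c /\ specialization L' u2 a c.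
have Rh : partial_hom R.
  split=> [a b c [b1 _] [c1 _]||a b c d [b1 b2] [c1 c2]|a b c d [b1 b2] [c1 c2]].
  - exact: (phom_uniq Rh1 b1 c1).
  - by split; [apply: phom1 Rh1 | apply: phom1 Rh2].
  - by split; [apply: phomB Rh1 _ _ _ _ _ _ | apply: phomB Rh2 _ _ _ _ _ _].
  - by split; [apply: phomM Rh1 _ _ _ _ _ _ | apply: phomM Rh2 _ _ _ _ _ _].
have F0 := seed_char0 (seedP S').
have spec_id u x : x \in L' -> specialization L' u x (u x : rat).
  by apply: specialization_gen => //; exact: pchar_num.
have [|c] := surjective_phom_total Rh _ (alg_lift z).
  (* The image variables are 1 at either point, so the pattern of [S] at the constant 1 computes
     both values. *)
  move=> s l sX lL; exists (pvar L (bmx (seed_of S)) (fun=> 1) s l).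
  have u0 : nonneg_off L None (fun=> 1 : rat) by [].
  have pos s' : {subset s' <= cluster S} ->
      nonneg_off L None (pvar L (bmx (seed_of S)) (fun=> 1 : rat) s').
    by move=> s'X; apply: pvar_nonneg => // k /s'X/cluster_sub.
  have spec_u (u : _ -> rat) : (forall l, l \in L -> u (img l) = 1) ->
      specialization L' u (svar (map img s) (img l))
        (pvar L (bmx (seed_of S)) (fun=> 1) s l).
    move=> u_img; rewrite svar_img //.
    apply: (phom_pvar (place_rat u)) => // [a d|j jL|j /sX/cluster_sub //|].
    - apply: specialization_inv => //; first exact: pchar_num.
      exact: seed_independent (seedP S').
    - by rewrite -(u_img _ jL); apply/spec_id/img_xcluster.
    move=> s' k s's ks; have kL := cluster_sub (sX _ ks).
    by have [|_ /(_ isT) /gt_eqF ->] := pos s' _ k kL; first by move=> j /s's/sX.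
  split; apply: spec_u => // j jL; rewrite /u2; case: eqP => // e.
  by case: nz; exists j.
rewrite alg_liftK // => -[/(phom_uniq Rh1 (spec_id _ _ zL)) <-].
by move=> /(phom_uniq Rh2 (spec_id _ _ zL)); rewrite /u2 eqxx.
Qed.

Lemma xcluster_img : L' = [fset img l | l in L].
Proof.
apply/fsetP => z; apply/idP/imfsetP => [/img_xcluster_surj[l lL <-]|[l /= lL ->]].
  by exists l.
exact: img_xcluster.
Qed.

(** Evaluation at [psi], which sends each [img l] back to [l], is a left inverse of [f]. *)
Lemma img_inj_injective : {in L &, injective img} -> injective f.
Proof.
move=> inj; have [psi psiK] : exists psi, forall l, l \in L -> psi (img l) = l.
  pose P z l := z \in [fset img l | l in L] -> l \in L /\ img l = z.
  have /choice[psi psiP] : forall z, exists l, P z l.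
    move=> z; have [/imfsetP[l /= lL ->]|/negPf zN] :=
      boolP (z \in [fset img l | l in L]); first by exists l.
    by exists 0; rewrite /P zN.
  exists psi => l lL; have [|pL e] := psiP (img l); first by rewrite in_imfset.
  exact: inj.
have F0 := seed_char0 (seedP S); have F0' := seed_char0 (seedP S').
have Lfree' := seed_independent (seedP S').
have Rh : partial_hom (specialization L' psi) by exact: specialization_hom.
have fR a : specialization L' psi (val (f a)) (val a).
  elim/cluster_alg_ind: a => [|u v Ru Rv|u v Ru Rv|s l sX lL].
  - by rewrite !rmorph1; apply: phom1 Rh.
  - by rewrite !rmorphB; apply: phomB Rh _ _ _ _ _ _.
  - by rewrite !rmorphM; apply: phomM Rh _ _ _ _ _ _.
  have [_ /(_ l lL)] := img_svar sX; rewrite /img alg_lift_svar // => ->.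
  rewrite svar_img //; apply: (phom_pvar Rh) => // [a c||j /sX/cluster_sub //|].
  - exact: specialization_inv.
  - move=> j jL; have := specialization_gen psi F0' F0 (img_xcluster jL).
    by rewrite psiK.
  move=> s' k s's ks; apply: svar_neq0; last exact/cluster_sub/sX.
  by move=> j /s's/sX.
by move=> a c fac; apply/val_inj/(phom_uniq Rh (fR a)); rewrite fac.
Qed.

End NoncontractibleMorphism.

(** * Morphisms defined by the images of the initial variables *)

Lemma map_inP (T U : eqType) (h : T -> U) (A : {pred T}) (B : {pred U}) s' :
  (forall y, y \in B -> exists2 x, x \in A & h x = y) ->
  {subset s' <= B} -> exists2 s, {subset s <= A} & s' = map h s.
Proof.
move=> hB; elim: s' => [|y s' IH] sB; first by exists [::].
have [x xA <-] := hB y (sB _ (mem_head _ _)).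
have [|s sA ->] := IH; first by move=> z zs; apply: sB; rewrite inE zs orbT.
by exists (x :: s) => // z; rewrite inE => /orP[/eqP ->|/sA].
Qed.

Section ExtendMorphism.
Variables S S' : seed.
Variable phi : seed_field S -> seed_field S'.
Hypothesis phi_cluster : {in cluster S, forall k, phi k \in cluster S'}.
Hypothesis phi_xcluster : {in xcluster S, forall l, phi l \in xcluster S'}.

Lemma phi_seq s : {subset s <= cluster S} -> {subset map phi s <= cluster S'}.
Proof. by move=> sX _ /mapP[k /sX kX ->]; apply: phi_cluster. Qed.

(** Admissible sequences come from label sequences, so the values on [svar s l] decide the mutation
    condition. *)
Lemma rooted_cluster_morphism_svar
    (f : {rmorphism cluster_algebra S -> cluster_algebra S'}) :
  (forall s l, {subset s <= cluster S} -> l \in xcluster S ->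
     img f (svar s l) = svar (map phi s) (phi l)) ->
  rooted_cluster_morphism f.
Proof.
move=> fE; have fx (x : cluster_algebra S) : val x \in xcluster S ->
    val (f x) = phi (val x).
  move=> xL; have <- : img f (val x) = phi (val x) by apply: (fE [::]).
  by rewrite /img alg_lift_val.
split=> [x xL|x xX|us y z].
- by left; rewrite fx ?phi_xcluster.
- by left; rewrite fx ?phi_cluster // cluster_sub.
rewrite /biadmissible => /andP[/admissible_sseq[s sX us1] _] yL.
have us2 : [seq val (f u) | u <- us] = sseq (map phi s).
  transitivity (map (img f) (map val us)).
    by rewrite -map_comp; apply: eq_map => u /=; rewrite /img alg_lift_val.
  rewrite us1 {us1}; elim/last_ind: s sX => [//|s k IH] skX.
  have [sX kX] := sub_rcons skX; have kL := cluster_sub kX.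
  by rewrite map_rcons /sseq !pseq_rcons map_rcons [map _ _]IH //; congr rcons;
    apply: fE.
rewrite us1 us2; have [_ _ ->//] := sseqP sX => zE.
have [_ _ ->] := sseqP (phi_seq sX); last by rewrite fx ?phi_xcluster.
by rewrite (fx y) // -fE // -zE /img alg_lift_val.
Qed.

Hypothesis phi_svar : forall s l, {subset s <= cluster S} -> l \in xcluster S ->
  pvar (xcluster S) (bmx (seed_of S)) phi s l = svar (map phi s) (phi l).

Lemma svar_specialization_phi s l : {subset s <= cluster S} -> l \in xcluster S ->
  specialization (xcluster S) phi (svar s l) (svar (map phi s) (phi l)).
Proof.
move=> sX lL; rewrite -phi_svar //; apply: svar_specialization => //.
  exact: seed_char0 (seedP S').
move=> s' k s's ks; have kX := sX _ ks; have kL := cluster_sub kX.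
have s'X : {subset s' <= cluster S} by move=> j /s's/sX.
by rewrite phi_svar // (svar_neq0 (phi_seq s'X)) ?phi_xcluster.
Qed.

Lemma specialization_phi_hom : partial_hom (specialization (xcluster S) phi).
Proof.
apply: specialization_hom; [exact: seed_char0 (seedP S) |
  exact: seed_char0 (seedP S') | exact: seed_independent (seedP S)].
Qed.

(** By [phi_svar] no mutated variable vanishes at [phi], so evaluation is defined on all generators
    and sends them to generators. *)
Lemma extend_morphism :
  exists f : {rmorphism cluster_algebra S -> cluster_algebra S'},
    [/\ rooted_cluster_morphism f,
        forall a, specialization (xcluster S) phi (val a) (val (f a))
      & forall s l, {subset s <= cluster S} -> l \in xcluster S ->
          img f (svar s l) = svar (map phi s) (phi l)].
Proof.
have Rh := specialization_phi_hom.
have [|f fR] := phom_extend (G := @generator S) (H := @generator S') Rh.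
  move=> x /generatorP[s [l [sX lL ->]]].
  exists (svar (map phi s) (phi l)); first exact: svar_specialization_phi.
  apply/generatorP; exists (map phi s), (phi l).
  by split=> //; [apply: phi_seq | apply: phi_xcluster].
have fE s l : {subset s <= cluster S} -> l \in xcluster S ->
    img f (svar s l) = svar (map phi s) (phi l).
  move=> sX lL; apply: (phom_uniq Rh) (svar_specialization_phi sX lL).
  by have := fR (alg_lift (svar s l)); rewrite alg_lift_svar.
by exists f; split=> //; apply: rooted_cluster_morphism_svar.
Qed.

Lemma svar_surjective (f : {rmorphism cluster_algebra S -> cluster_algebra S'}) :
  (forall k', k' \in cluster S' -> exists2 k, k \in cluster S & phi k = k') ->
  (forall l', l' \in xcluster S' -> exists2 l, l \in xcluster S & phi l = l') ->
  (forall s l, {subset s <= cluster S} -> l \in xcluster S ->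
     img f (svar s l) = svar (map phi s) (phi l)) ->
  surjective_map f.
Proof.
move=> phiX phiL fE; elim/cluster_alg_ind => [|_ _ [u <-] [v <-]|_ _ [u <-] [v <-]|].
- by exists 1; rewrite rmorph1.
- by exists (u - v); rewrite rmorphB.
- by exists (u * v); rewrite rmorphM.
move=> s' l' /(map_inP phiX)[s sX ->] /phiL[l lL <-].
by exists (alg_lift (svar s l)); rewrite -fE // /img alg_lift_val.
Qed.

End ExtendMorphism.

(** * Generated subfields *)

Section GeneratedSubfield.
Variables (F : fieldType) (A : {fset F}).

Definition subfield_gen : {pred F} := fun a =>
  `[< forall P : {pred F}, divring_closed P -> {subset A <= P} -> a \in P >].

Lemma subfield_gen_closed : divring_closed subfield_gen.
Proof.
split=> [|a b /asboolP aA /asboolP bA|a b /asboolP aA /asboolP bA];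
  apply/asboolP => P Pdiv AP; have [P1 PB PV] := Pdiv.
- exact: P1.
- by apply: PB; [apply: aA | apply: bA].
- by apply: PV; [apply: aA | apply: bA].
Qed.

Lemma subfield_gen_sub a : a \in A -> a \in subfield_gen.
Proof. by move=> aA; apply/asboolP => P _; apply. Qed.

HB.instance Definition _ :=
  GRing.isDivringClosed.Build F subfield_gen subfield_gen_closed.

Record gen_subfield :=
  GenSubfield { gen_subfield_val : F; _ : gen_subfield_val \in subfield_gen }.

HB.instance Definition _ := [isSub for gen_subfield_val].
HB.instance Definition _ := [Choice of gen_subfield by <:].
HB.instance Definition _ := [SubChoice_isSubIntegralDomain of gen_subfield by <:].
HB.instance Definition _ := [SubIntegralDomain_isSubField of gen_subfield by <:].

(** Generation inside the subfield itself, as a seed demands: the values of the members of [P] are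
    closed under subtraction and division in [F]. *)
Lemma gen_subfield_generated (P : {pred gen_subfield}) : divring_closed P ->
  (forall u : gen_subfield, val u \in A -> u \in P) -> forall u, u \in P.
Proof.
move=> [P1 PB PV] AP u.
pose Q : {pred F} := fun a => `[< exists2 v : gen_subfield, val v = a & v \in P >].
suff /asboolP[v /val_inj <-] : val u \in Q by [].
have /asboolP := valP u; apply; first split.
- by apply/asboolP; exists 1; rewrite ?rmorph1.
- move=> _ _ /asboolP[a <- Pa] /asboolP[b <- Pb]; apply/asboolP.
  by exists (a - b); [rewrite rmorphB | apply: PB].
- move=> _ _ /asboolP[a <- Pa] /asboolP[b <- Pb]; apply/asboolP.
  by exists (a / b); [rewrite fmorph_div | apply: PV].
move=> a aA; apply/asboolP; exists (GenSubfield (subfield_gen_sub aA)) => //.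
exact: AP.
Qed.

End GeneratedSubfield.

(** * Gluing two frozen variables *)

Lemma mulr_ge0_sign (p q : int) :
  0 <= p * q -> (0 <= p /\ 0 <= q) \/ (p <= 0 /\ q <= 0).
Proof. by nia. Qed.

(** Absolute value is additive on integers of the same sign, and the numerators are even, so halving
    distributes over the sum. *)
Lemma coherent_mutation (a p q : int) : 0 <= p * q ->
  ((`|a| * (p + q) + a * `|p + q|) %/ 2)%Z =
  ((`|a| * p + a * `|p|) %/ 2)%Z + ((`|a| * q + a * `|q|) %/ 2)%Z.
Proof.
move=> /mulr_ge0_sign pq; have -> : `|p + q| = `|p| + `|q| by lia.
have even x : exists m, `|a| * x + a * `|x| = m * 2.
  have [a0|a0] := ger0P a; have [x0|x0] := ger0P x.
  - by exists (a * x); lia.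
  - by exists 0; lia.
  - by exists 0; lia.
  - by exists (- (a * x)); lia.
have [m em] := even p; have [n en] := even q.
by rewrite !mulrDr addrACA em en -mulrDl !mulzK.
Qed.

Lemma pospartD (p q : int) : 0 <= p * q ->
  pospart (p + q) = (pospart p + pospart q)%N.
Proof.
move=> /mulr_ge0_sign pq.
have pE (n : int) : pospart n = Num.max n 0 :> int by case: n => n /=; lia.
by apply/eqP; rewrite -eqz_nat PoszD !pE; lia.
Qed.

Section Gluing.
Variable S : seed.
Variables y1 y2 : seed_field S.
Let F := seed_field S.
Let X := cluster S.
Let L := xcluster S.
Let b := bmx (seed_of S).
Hypotheses (y1Y : y1 \in frozen S) (y2Y : y2 \in frozen S) (y12 : y1 != y2).
Hypothesis coherent : forall s k, {subset s <= X} -> k \in X ->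
  0 <= smx s k y1 * smx s k y2.
Implicit Types (s : seq F) (k l : F).

(* The gluing variable is represented by [y1] inside the subfield generated by
   the variables other than [y2]. *)
Definition glue_field : fieldType := gen_subfield (L `\ y2).

Definition glue l : glue_field := insubd 0 (if l == y2 then y1 else l).

(** The column of the representative [y1] absorbs that of [y2]. *)
Definition glue_bmx (x y : glue_field) : int :=
  b (val x) (val y) + (if val y == y1 then b (val x) y2 else 0).

Definition glue_data : seed_data glue_field :=
  SeedData [fset glue k | k in X] [fset glue l | l in frozen S] glue_bmx.

Let y1L : y1 \in L. Proof. exact: frozen_sub. Qed.
Let y2L : y2 \in L. Proof. exact: frozen_sub. Qed.

Lemma val_glue l : l \in L -> val (glue l) = if l == y2 then y1 else l.
Proof.
move=> lL; rewrite val_insubd subfield_gen_sub // in_fsetD1.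
by case: (eqVneq l y2) => [_|ly]; rewrite ?y12 ?y1L ?ly ?lL.
Qed.

Lemma cluster_neq k l : l \in frozen S -> k \in X -> k != l.
Proof.
move=> lY kX; apply: contraTneq lY => <-.
by apply: (fdisjointP (seed_disjoint (seedP S))).
Qed.

Lemma val_glue_cluster k : k \in X -> val (glue k) = k.
Proof.
by move=> kX; rewrite val_glue ?cluster_sub // (negPf (cluster_neq y2Y kX)).
Qed.

Lemma glue_eq_cluster l k : l \in L -> k \in X -> (glue l == glue k) = (l == k).
Proof.
move=> lL kX; rewrite -val_eqE (val_glue_cluster kX) (val_glue lL).
have := cluster_neq y1Y kX; have := cluster_neq y2Y kX.
by case: (eqVneq l y2) => [->|//]; rewrite ![k == _]eq_sym => /negPf-> /negPf->.
Qed.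

Lemma glue_y2 : glue y2 = glue y1.
Proof. by rewrite /glue eqxx (negPf y12). Qed.

Lemma ext_glue : ext glue_data = [fset glue l | l in L `\ y2].
Proof.
apply/fsetP => z; rewrite /ext /= -imfsetU.
apply/imfsetP/imfsetP => /= -[l lL ->].
  have [->|ly] := eqVneq l y2; last by exists l; rewrite // in_fsetD1 ly.
  by exists y1; rewrite ?glue_y2 // in_fsetD1 y12.
by exists l => //; move: lL; rewrite in_fsetD1 => /andP[].
Qed.

Lemma glue_inj : {in L `\ y2 &, injective glue}.
Proof.
move=> l l'; rewrite !in_fsetD1 => /andP[ly lL] /andP[l'y l'L] /(congr1 val).
by rewrite !val_glue // (negPf ly) (negPf l'y).
Qed.

(** By coherence the mutation rule is additive in the columns of [y1] and [y2], so their sum remains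
    the glued column. *)
Lemma glue_mx s k l : {subset s <= X} -> k \in X -> l \in L ->
  foldl (@mutate_mx glue_field) glue_bmx (map glue s) (glue k) (glue l) =
  if (l == y1) || (l == y2) then smx s k y1 + smx s k y2 else smx s k l.
Proof.
elim/last_ind: s k l => [|s j IH] k l skX kX lL.
  rewrite /= /glue_bmx val_glue_cluster // val_glue // /smx /=.
  case: (eqVneq l y2) => [->|_]; rewrite ?orbT ?eqxx //= orbF.
  by case: eqVneq => [->//|_]; rewrite addr0.
have [sX jX] := sub_rcons skX; have jL := cluster_sub jX; have kL := cluster_sub kX.
rewrite /smx map_rcons !foldl_rcons {1}/mutate_mx !glue_eq_cluster //.
rewrite !IH // -!/(smx s).
have jN : (j == y1) || (j == y2) = false.
  by rewrite (negPf (cluster_neq y1Y jX)) (negPf (cluster_neq y2Y jX)).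
rewrite jN; have [ly|_] := boolP ((l == y1) || (l == y2)); last by [].
have lj : (l == j) = false.
  by apply: contraFF jN => /eqP <-.
rewrite lj orbF /mutate_mx ![y1 == j]eq_sym ![y2 == j]eq_sym.
move/norP: (negbT jN) => [/negPf -> /negPf ->]; rewrite !orbF.
case: ifP => _; first by rewrite opprD.
by rewrite coherent_mutation ?coherent // addrACA.
Qed.

(** The labels [y1] and [y2] carry equal values and their exponents add without cancellation. A
    general [K] serves both the canonical map and the induced one. *)
Lemma glue_pvar (K : fieldType) (v : F -> K) (v' : glue_field -> K) s l :
  {in L, forall l, v' (glue l) = v l} -> {subset s <= X} -> l \in L ->
  pvar (ext glue_data) glue_bmx v' (map glue s) (glue l) = pvar L b v s l.
Proof.
move=> v'E; elim/last_ind: s l => [|s k IH] l skX lL; first exact: v'E.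
have [sX kX] := sub_rcons skX.
rewrite map_rcons !pvar_rcons /pstep glue_eq_cluster //.
case: eqVneq => _; last exact: IH.
have kL := cluster_sub kX; rewrite IH //; congr (_ * _).
set w' := pvar _ glue_bmx _ _; set w := pvar L _ _ _.
have w'E j : j \in L -> w' (glue j) = w j by apply: IH.
(* [e] will be the identity and negation, one for each monomial. *)
have prodE (e : int -> int) : (forall p q, e (p + q) = e p + e q) ->
    (forall p q, e p * e q = p * q) ->
    \prod_(t <- ext glue_data) w' t ^+ pospart (e (foldl (@mutate_mx glue_field)
       glue_bmx (map glue s) (glue k) t)) =
    \prod_(t <- L) w t ^+ pospart (e (smx s k t)).
  move=> eD eM; rewrite ext_glue prod_imfset; last exact: glue_inj.
  have y1L' : y1 \in L `\ y2 by rewrite in_fsetD1 y12.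
  rewrite [RHS](big_fsetD1 y2) //= !(big_fsetD1 y1 y1L') /= mulrA.
  congr (_ * _).
    rewrite glue_mx // eqxx eD pospartD ?eM ?coherent // exprD w'E //.
    by rewrite mulrC -(w'E y2) // glue_y2 w'E.
  rewrite big_seq [RHS]big_seq; apply: eq_bigr => t.
  rewrite !in_fsetD1 => /and3P[ty1 ty2 tL].
  by rewrite w'E // glue_mx // (negPf ty1) (negPf ty2).
by congr (_ + _); [apply: (prodE id) | apply: (prodE -%R)] => * //;
  rewrite ?opprD ?mulrNN.
Qed.

Lemma glue_val (x : glue_field) : x \in ext glue_data ->
  val x \in L `\ y2 /\ glue (val x) = x.
Proof.
rewrite ext_glue => /imfsetP[l /= lL ->]; move: (lL).
by rewrite in_fsetD1 => /andP[/negPf ly ?]; rewrite val_glue // ly.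
Qed.

Lemma glue_clusterP (x : glue_field) : x \in exch glue_data ->
  exists2 k, k \in X & glue k = x.
Proof. by move=> /imfsetP[k /= kX ->]; exists k. Qed.

Lemma glue_is_seed : is_seed glue_data.
Proof.
have [F0 disj Lfree Lgen tsss] := seedP S.
split.
- by move=> p; rewrite -(fmorph_pchar (val : {rmorphism glue_field -> F})) F0.
- apply/fdisjointP => z /glue_clusterP[k kX <-]; apply/imfsetP => -[l /= lY].
  by move/eqP; rewrite eq_sym glue_eq_cluster ?frozen_sub // eq_sym
    (negPf (cluster_neq lY kX)).
- apply: (alg_independent_sub (f := (val : {rmorphism glue_field -> F}))) Lfree _ => //.
  move=> _ /imfsetP[z /= /glue_val[zL _] ->]; move: zL.
  by rewrite in_fsetD1 => /andP[].
- move=> P Pdiv LP; apply: gen_subfield_generated => // u uL; apply: LP.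
  rewrite ext_glue; apply/imfsetP; exists (val u) => //; apply/val_inj.
  by move: uL; rewrite in_fsetD1 => /andP[/negPf uy uL]; rewrite val_glue // uy.
(* On exchangeable labels the glued matrices agree with those of [S]. *)
move=> s' /(map_inP glue_clusterP)[s sX ->] _ _ /glue_clusterP[x xX <-]
  /glue_clusterP[y yX <-].
have := tsss s sX x y xX yX; rewrite !glue_mx ?cluster_sub //.
by rewrite !(negPf (cluster_neq _ _)).
Qed.

Definition glue_seed : seed := Seed glue_is_seed.

Lemma glue_cluster : {in X, forall k, glue k \in cluster glue_seed}.
Proof. by move=> k kX; apply/imfsetP; exists k. Qed.

Lemma glue_xclusterP (x : glue_field) : x \in xcluster glue_seed ->
  exists2 l, l \in L & glue l = x.
Proof.
move=> /glue_val[xL xE]; exists (val x) => //.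
by move: xL; rewrite in_fsetD1 => /andP[].
Qed.

Lemma glue_xcluster : {in L, forall l, glue l \in xcluster glue_seed}.
Proof.
move=> l lL; rewrite /xcluster [_ \in _](_ : _ = (glue l \in ext glue_data)) //.
rewrite ext_glue; have [->|ly] := eqVneq l y2.
  by rewrite glue_y2 in_imfset //= in_fsetD1 y12.
by rewrite in_imfset //= in_fsetD1 ly.
Qed.

Lemma glue_svar s l : {subset s <= X} -> l \in L ->
  pvar L b glue s l = @svar glue_seed (map glue s) (glue l).
Proof. by move=> sX lL; rewrite -(glue_pvar (v' := id)). Qed.

Lemma card_glue : #|` L| = #|` xcluster glue_seed|.+1.
Proof.
rewrite (cardfsD1 y2) y2L add1n; congr _.+1; apply/esym.
rewrite /xcluster [ext _](_ : _ = ext glue_data) // ext_glue.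
by apply: card_in_imfset; apply: glue_inj.
Qed.

Lemma glue_is_glued_seed : @is_glued_seed S glue_seed y1 y2 glue (glue y1).
Proof.
have mem l : l \in L `\` [fset y1; y2] -> [/\ l \in L, l != y1 & l != y2].
  by rewrite in_fsetD in_fset2 negb_or => /andP[/andP[-> ->] ->].
split=> //.
- move=> l l' /mem[lL _ ly] /mem[l'L _ l'y].
  by apply: glue_inj; rewrite in_fsetD1 ?ly ?l'y.
- move=> l /mem[lL ly1 ly2]; rewrite (inj_in_eq glue_inj) //.
    by rewrite in_fsetD1 ly2.
  by rewrite in_fsetD1 y12.
- apply/fsetP => z; rewrite in_fset1U; apply/imfsetP/orP => /= [[l lY ->]|].
    have [->|ly1] := eqVneq l y1; first by left.
    have [->|ly2] := eqVneq l y2; first by left; rewrite glue_y2.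
    right; apply/imfsetP; exists l => //=.
    by rewrite in_fsetD in_fset2 negb_or ly1 ly2.
  case=> [/eqP ->|/imfsetP[l /=]]; first by exists y1.
  by rewrite in_fsetD => /andP[_ lY] ->; exists l.
- move=> k l kX /mem[lL ly1 ly2] /=; rewrite /glue_bmx val_glue_cluster //.
  by rewrite val_glue // (negPf ly2) (negPf ly1) addr0.
move=> k kX /=; rewrite /glue_bmx val_glue_cluster // val_glue //.
by rewrite (negPf y12) eqxx.
Qed.

(** The substitution is evaluation at [glue] on the Laurent ring; exchangeable variables may be
    inverted because their images are nonzero. *)
Lemma glue_canonical (fj : cluster_algebra S -> cluster_algebra glue_seed) :
  (forall a, specialization L glue (val a) (val (fj a))) ->
  @canonical_gluing S glue_seed y1 y2 glue (glue y1) fj.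
Proof.
move=> fjE; have F0 := seed_char0 (seedP S).
have F0' : [pchar glue_field] =i pred0 := seed_char0 glue_is_seed.
have Lfree := seed_independent (seedP S).
have Rh : partial_hom (specialization L glue) by exact: specialization_hom.
have Rgen l : l \in L -> specialization L glue l (glue l).
  exact: specialization_gen.
have [|p pE] := phom_total (phom_subl (fun x : F =>
    [\/ exists q : rat, x = ratr q, x \in xcluster S
      | exists2 y, y \in cluster S & x = y^-1]) Rh).
  apply: gen_ring_ind => [|u v [c Ru] [d Rv]|u v [c Ru] [d Rv]|u].
  - by exists 1; rewrite !rmorph1; apply: phom1 Rh.
  - by exists (c - d); rewrite !rmorphB; apply: phomB Rh _ _ _ _ _ _.
  - by exists (c * d); rewrite !rmorphM; apply: phomM Rh _ _ _ _ _ _.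
  case=> [[q ->]|uL|[k kX ->]].
  - by exists (ratr q); apply: specialization_rat.
  - by exists (glue (val u)); apply: Rgen.
  exists (glue k)^-1; apply: specialization_inv => //.
    exact/Rgen/cluster_sub.
  apply: (svar_neq0 (S := glue_seed) (s := [::])) => //.
  exact/glue_xcluster/cluster_sub.
exists p; split=> [x|x|a l al].
- rewrite in_fsetD => /andP[_ /Rgen]; exact: (phom_uniq Rh (pE x)).
- rewrite in_fset2 => /orP[] /eqP e; apply: (phom_uniq Rh (pE x)).
    by rewrite e; apply: Rgen.
  by rewrite -glue_y2 e; apply: Rgen.
by apply: (phom_uniq Rh (fjE a)); rewrite al; apply: pE.
Qed.

End Gluing.

(** * Splitting off gluings one at a time *)

Section GluingStep.
Variables S S' : seed.
Variable f : {rmorphism cluster_algebra S -> cluster_algebra S'}.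
Hypotheses (f_morph : rooted_cluster_morphism f) (f_surj : surjective_map f).
Hypothesis f_noncontr : noncontractible f.

Lemma gluing_step y1 y2 : y1 \in xcluster S -> y2 \in xcluster S -> y1 != y2 ->
  img f y1 = img f y2 ->
  exists (S1 : seed) (e : seed_field S -> seed_field S1) (ybar : seed_field S1)
    (fj : {rmorphism cluster_algebra S -> cluster_algebra S1})
    (g : {rmorphism cluster_algebra S1 -> cluster_algebra S'}),
    [/\ is_glued_seed y1 y2 e ybar, canonical_gluing y1 y2 e ybar fj,
        rooted_cluster_morphism fj & surjective_map fj] /\
    [/\ rooted_cluster_morphism g, surjective_map g, noncontractible g,
        forall a, f a = g (fj a)
      & #|` xcluster S| = #|` xcluster S1|.+1].
Proof.
move=> y1L y2L y12 e12.
have froz y y' : y \in xcluster S -> y' \in xcluster S -> y != y' ->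
    img f y = img f y' -> y \in frozen S.
  move=> yL y'L yy' e; rewrite frozenE //; apply: contra yy' => yX.
  by apply/eqP; apply: (img_inj_cluster f_morph f_noncontr yX y'L e).
have y1Y : y1 \in frozen S by apply: froz e12.
have y2Y : y2 \in frozen S by apply: (froz y2 y1); rewrite // eq_sym.
have coh s k : {subset s <= cluster S} -> k \in cluster S ->
    0 <= smx s k y1 * smx s k y2.
  move=> sX kX; have c := img_coherent f_morph f_noncontr sX kX.
  have := c _ _ y1L y2L e12; have := c _ _ y2L y1L (esym e12).
  move: (smx s k y1) (smx s k y2) => p q qp pq.
  have [] : (0 <= p /\ 0 <= q) \/ (p <= 0 /\ q <= 0) by lia.
    by case; apply: mulr_ge0.
  by case; apply: mulr_le0.
pose S1 := glue_seed y1Y y2Y y12 coh; pose gl : _ -> seed_field S1 := glue y1 y2.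
have glX := glue_cluster y1Y y2Y y12 coh.
have glL := glue_xcluster y1Y y2Y y12 coh.
have glX' (x : seed_field S1) :
    x \in cluster S1 -> exists2 k, k \in cluster S & gl k = x.
  exact: glue_clusterP.
have glL' (x : seed_field S1) :
    x \in xcluster S1 -> exists2 l, l \in xcluster S & gl l = x.
  exact: glue_xclusterP.
have [fj [fj_m fj_spec fjE]] := extend_morphism glX glL
  (fun s l => glue_svar y1Y y2Y y12 coh (s := s) (l := l)).
have fj_surj : surjective_map fj by apply: svar_surjective glX' glL' fjE.
(* The representative [y1] has the image of both glued variables, so [psi] is compatible with
   gluing. *)
pose psi (x : seed_field S1) := img f (val x).
have psiE l : l \in xcluster S -> psi (gl l) = img f l.
  by move=> lL; rewrite /psi val_glue //; case: eqVneq => // ->.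
have map_psi s : {subset s <= cluster S} -> map psi (map gl s) = map (img f) s.
  move=> sX; rewrite -map_comp; apply/eq_in_map => k /sX/cluster_sub.
  exact: psiE.
have [g [g_m g_spec gE]] : exists g : {rmorphism cluster_algebra S1 -> cluster_algebra S'},
    [/\ rooted_cluster_morphism g,
        forall a, specialization (xcluster S1) psi (val a) (val (g a))
      & forall s l, {subset s <= cluster S1} -> l \in xcluster S1 ->
          img g (svar s l) = svar (map psi s) (psi l)].
  apply: extend_morphism.
  - move=> _ /glX'[k kX <-]; rewrite psiE ?cluster_sub //.
    exact: (img_cluster f_morph f_noncontr kX).
  - move=> _ /glL'[l lL <-]; rewrite psiE //.
    exact: (img_xcluster f_morph f_noncontr lL).
  move=> s' l' /(map_inP glX')[s sX ->] /glL'[l lL <-].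
  rewrite map_psi // psiE // (svar_img f_morph f_noncontr) //.
  by apply: glue_pvar.
have fg a : f a = g (fj a).
  elim/cluster_alg_ind: a => [|u v fu fv|u v fu fv|s l sX lL].
  - by rewrite !rmorph1.
  - by rewrite !rmorphB fu fv.
  - by rewrite !rmorphM fu fv.
  apply/val_inj; have [_ /(_ l lL) e] := img_svar f_morph f_noncontr sX.
  rewrite -[LHS]/(img f (svar s l)) e.
  have glsX : {subset map gl s <= cluster S1} by move=> _ /mapP[k /sX/glX kX ->].
  have := gE _ _ glsX (glL _ lL); rewrite map_psi // psiE // => <-.
  by rewrite -fjE // /img alg_lift_val.
exists S1, gl, (gl y1), fj, g; split; split=> //.
- exact: glue_is_glued_seed.
- exact: glue_canonical.
- by move=> c; have [a <-] := f_surj c; exists (fj a); rewrite fg.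
- move=> x /glL'[l lL lx] [n gx]; apply: (f_noncontr (x := alg_lift l)).
    by rewrite alg_liftK.
  exists n; rewrite fg -gx; congr (g _); apply: val_inj; rewrite -lx.
  by apply: (fjE [::]).
exact: card_glue.
Qed.

End GluingStep.

(** [n] is the excess of variables. At 0, equal cardinalities make [img g] injective; otherwise two
    variables collide, and gluing them lowers the excess. *)
Lemma gluing_chain_factorization (S S' : seed)
    (f : {rmorphism cluster_algebra S -> cluster_algebra S'}) (n : nat) i Si h
    (g : {rmorphism cluster_algebra Si -> cluster_algebra S'}) :
  gluing_chain f i h g -> rooted_cluster_morphism g -> surjective_map g ->
  noncontractible g -> (forall a, f a = g (h a)) ->
  #|` xcluster Si| = (#|` xcluster S'| + n)%N ->
  exists (Ss : seed) (h : cluster_algebra S -> cluster_algebra Ss)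
      (im : cluster_algebra Ss -> cluster_algebra S')
      (g : {rmorphism cluster_algebra Ss -> cluster_algebra S'}),
    [/\ gluing_chain f (i + n) h im, rooted_cluster_isomorphism g
      & forall a, f a = g (h a)].
Proof.
elim: n i Si h g => [|n IH] i Si h g ch g_m g_s g_n fE card.
  exists Si, h, g, g; rewrite addn0; split=> //; split=> //.
  apply: img_inj_injective => //; apply/card_in_imfsetP.
  by rewrite -xcluster_img // card addn0.
have [y1 [y2 [y1L y2L y12 e12]]] : exists y1 y2, [/\ y1 \in xcluster Si,
    y2 \in xcluster Si, y1 != y2 & img g y1 = img g y2].
  apply: contrapT => no; suff /card_in_imfsetP/eqP : {in xcluster Si &, injective (img g)}.
    by rewrite -xcluster_img // card; lia.
  move=> y1 y2 y1L y2L e12; apply/eqP/contraT => y12; case: no.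
  by exists y1, y2.
have [S1 [e [ybar [fj [g1 [[gs can fj_m fj_s] [g1_m g1_s g1_n gE card1]]]]]]] :=
  gluing_step g_m g_s g_n y1L y2L y12 e12.
rewrite addnS -addSn; apply: IH g1_m g1_s g1_n _ _; last by lia.
  (* The recorded image map is [g1] itself, since [g] is [g1] after [fj]. *)
  apply: (GluingChainS (y1 := alg_lift y1) (y2 := alg_lift y2)) ch _ _ _ fj_m fj_s _.
  - exact/val_inj.
  - rewrite !alg_liftK //; exact: gs.
  - rewrite !alg_liftK //; exact: can.
  by move=> x _; rewrite gE.
by move=> a; rewrite fE gE.
Qed.

Theorem theorem6p21 (S S' : seed)
    (f : {rmorphism cluster_algebra S -> cluster_algebra S'})
    (f_morph : rooted_cluster_morphism f)
    (f_surj : surjective_map f)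
    (f_noncontr : noncontractible f) :
  exists s : nat,
    #|` xcluster S| = (#|` xcluster S'| + s)%N /\
    exists (Ss : seed) (h : cluster_algebra S -> cluster_algebra Ss)
        (im : cluster_algebra Ss -> cluster_algebra S')
        (g : {rmorphism cluster_algebra Ss -> cluster_algebra S'}),
      [/\ gluing_chain f s h im,
          rooted_cluster_isomorphism g
        & forall a, f a = g (h a)].
Proof.
(* [img f] maps onto the target extended cluster, so the truncated subtraction is exact. *)
have card : #|` xcluster S| =
    (#|` xcluster S'| + (#|` xcluster S| - #|` xcluster S'|))%N.
  rewrite subnKC // (xcluster_img f_morph f_noncontr f_surj).
  exact: leq_imfset_card.
exists (#|` xcluster S| - #|` xcluster S'|)%N; split=> //.
exact: gluing_chain_factorization (GluingChain0 f) f_morph f_surj f_noncontr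
  (fun=> erefl) card.
Qed.
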